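(* Let $P$ be a graph problem that has a deterministic (non-randomized) algorithm $\mathcal{M}$ in the random-access memory model which, given $G=(V,E)$ in adjacency list or adjacency matrix form, outputs $P(G)$ in time $t(m,n)$, where $m=|E|$ and $n=|V|$. Then in the annotation model there is an $(m+t(m,n),1)$ protocol for $P$ on graph streams.
   Context: Annotation model: a data stream $\mathcal{A}$ of length $m$ is observed by a probabilistic verifier $\mathcal{V}$ (private random string, $w(m)$ machine words of working memory, each word $\Theta(\log m)$ bits) and a deterministic helper $\mathcal{H}$. After the stream ends, $\mathcal{H}$ sends an annotation that $\mathcal{V}$ reads as a stream. $\mathcal{V}$ outputs a value or $\perp$. A helper is valid for $\mathcal{A}$ if $\mathcal{V}$ outputs $f(\mathcal{A})$ with probability 1; it is $\tfrac13$-invalid for $\mathcal{A}$ if $\mathcal{V}$ outputs something other than $\perp$ with probability at most $1/3$. A protocol for $f$ is valid if some helper is valid for every $\mathcal{A}$, and for every helper and every stream, the helper is either valid or $\tfrac13$-invalid. Help cost: maximum annotation length of a shortest valid helper; verification cost: $w(m)$ (in words). An $(h,v)$ protocol is a valid protocol with help cost $O(h+1)$ and verification cost $O(v+1)$. Graph stream: the stream lists the (possibly weighted) edges $e_i\in[n]\times[n]$ of $G$.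
   Formalization: Machine words have Θ(log(n+m)) bits instead of Θ(log m), since with n superpolynomial in m a vertex does not fit in O(1) words and the claim fails; the RAM is read as a word RAM with words of this order, edge weights fitting in O(1) words. *)

(* Defs.v *)
From HB Require Import structures.
From mathcomp Require Import all_boot all_order all_algebra.

Set Implicit Arguments.
Unset Strict Implicit.
Unset Printing Implicit Defensive.

Import Order.TTheory GRing.Theory Num.Theory.

(* Word length, c * ceil(log2 (n + m + 2)) bits: Theta(log (n + m)) for c > 0,
   which is Theta(log m) as soon as n is polynomially bounded in m.  The + 2
   keeps the logarithm positive on tiny inputs. *)
Definition word_bits (c n m : nat) : nat := c * up_log 2 (n + m + 2).

(* [G (u, v) = Some x]: there is an edge from u to v, of weight x.  An
   undirected graph is a symmetric [G]. *)
Definition graph (n : nat) : Type := {ffun 'I_n * 'I_n -> option nat}.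

(* A weighted edge (u, v, x), as it appears in a stream. *)
Definition edge (n : nat) : Type := ('I_n * 'I_n * nat)%type.

Definition edge_set (dir : bool) n (G : graph n) : {set 'I_n * 'I_n} :=
  [set e | isSome (G e) && (dir || (e.1 <= e.2))].

(* [weight_const] is the constant c for which weights are words of
   [word_bits c n m] bits; with c = 0 every weight is 0, i.e. the graphs are
   unweighted.  [instance] is the class of graphs on which the problem is posed
   (all graphs, loopless graphs, bipartite graphs, ...); [answer] is the output
   as a sequence of numbers. *)
Record graph_problem := GraphProblem {
  directed : bool;
  weight_const : nat;
  instance : forall n, graph n -> Prop;
  answer : forall n, graph n -> seq nat
}.

Definition problem_input (P : graph_problem) (n m : nat) (G : graph n) : Prop :=
  [/\ ~~ directed P -> forall u v, G (u, v) = G (v, u),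
      #|edge_set (directed P) G| = m,
      forall e x, G e = Some x -> x < 2 ^ word_bits (weight_const P) n m
    & instance P G].

Definition enumerates n (s : seq (edge n)) (G : graph n) : Prop :=
  uniq [seq a.1 | a <- s] /\ forall a : edge n, (a \in s) = (G a.1 == Some a.2).

(* An undirected edge occurs in the stream once, in either orientation, and
   stands for both orientations. *)
Definition arcs (dir : bool) n (A : seq (edge n)) : seq (edge n) :=
  flatten [seq if dir || (e.1.1 == e.1.2) then [:: e]
               else [:: e; (e.1.2, e.1.1, e.2)] | e <- A].

Definition graph_stream (P : graph_problem) n m (A : m.-tuple (edge n))
    (G : graph n) : Prop :=
  problem_input P m G /\ enumerates (arcs (directed P) A) G.

Inductive binop :=
  OpAdd | OpSub | OpMul | OpDiv | OpMod | OpAnd | OpOr | OpXor | OpShl | OpShr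
| OpEq | OpLt.

Inductive instr :=
| Const (r c : nat)
| Op (o : binop) (r x y : nat)
| Read (r a : nat)
| Write (a r : nat)
| Jz (r l : nat)
| Print (r : nat)
| Halt.

(* Arithmetic on words is modulo [B]; operands are smaller than [B]. *)
Definition eval_op (B : nat) (o : binop) (x y : nat) : nat :=
  match o with
  | OpAdd => x + y
  | OpSub => x + (B - y)
  | OpMul => x * y
  | OpDiv => x %/ y
  | OpMod => x %% y
  | OpAnd => Nat.land x y
  | OpOr => Nat.lor x y
  | OpXor => Nat.lxor x y
  | OpShl => x * 2 ^ y
  | OpShr => x %/ 2 ^ y
  | OpEq => x == y
  | OpLt => x < y
  end %% B.

Record config := Config {
  pc : nat;
  regs : nat -> nat;
  mem : nat -> nat;
  out : seq nat
}.

(* The machine also halts when it runs off the end of its program. *)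
Definition halted (p : seq instr) (s : config) : Prop :=
  nth Halt p (pc s) = Halt.

Definition step (B : nat) (p : seq instr) (s : config) : config :=
  let: Config i R M o := s in
  match nth Halt p i with
  | Const r c => Config i.+1 [eta R with r |-> c %% B] M o
  | Op f r x y => Config i.+1 [eta R with r |-> eval_op B f (R x) (R y)] M o
  | Read r a => Config i.+1 [eta R with r |-> M (R a)] M o
  | Write a r => Config i.+1 R [eta M with R a |-> R r] o
  | Jz r l => Config (if R r == 0 then l else i.+1) R M o
  | Print r => Config i.+1 R M (rcons o (R r))
  | Halt => s
  end.

(* n and m are initially in registers 0 and 1. *)
Definition ram_init (n m : nat) (mu : nat -> nat) : config :=
  Config 0 [eta (fun=> 0) with 0 |-> n, 1 |-> m] mu [::].

(* A program for the word RAM with words of [word_bits word_const n m] bits. *)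
Record ram_algorithm := RamAlgorithm {
  word_const : nat;
  program : seq instr
}.

Definition ram_run (M : ram_algorithm) (n m T : nat) (mu : nat -> nat) : config :=
  iter T (step (2 ^ word_bits (word_const M) n m) (program M)) (ram_init n m mu).

(* The 0/1 adjacency matrix, in row-major order, followed by the matrix of the
   weights (0 where there is no edge). *)
Definition adjacency_matrix n (G : graph n) (mu : nat -> nat) : Prop :=
  [/\ forall u v : 'I_n, mu (u * n + v) = isSome (G (u, v)),
      forall u v : 'I_n, mu (n * n + (u * n + v)) = odflt 0 (G (u, v))
    & forall a, 2 * (n * n) <= a -> mu a = 0].

(* Address of the first list node of index >= k with source u, 0 (nil) if there
   is none.  Node j is at address n + 3 * j, which is never 0. *)
Definition node_ptr n (s : seq (edge n)) (u : 'I_n) (k : nat) : nat :=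
  let j := k + find (fun a : edge n => a.1.1 == u) (drop k s) in
  if j < size s then n + 3 * j else 0.

(* Linked lists: cell u < n holds the head of the list of u; each arc, in some
   order s, has a node made of three cells (target, weight, next node). *)
Definition adjacency_list n (G : graph n) (mu : nat -> nat) : Prop :=
  exists2 s : seq (edge n), enumerates s G &
  [/\ forall u : 'I_n, mu u = node_ptr s u 0,
      forall i a, onth s i = Some a ->
        [/\ mu (n + 3 * i) = a.1.2, mu (n + 3 * i + 1) = a.2
          & mu (n + 3 * i + 2) = node_ptr s a.1.1 i.+1]
    & forall a, n + 3 * size s <= a -> mu a = 0].

Inductive input_form := AdjacencyList | AdjacencyMatrix.

Definition represents (f : input_form) n (G : graph n) (mu : nat -> nat) : Prop :=
  match f with
  | AdjacencyList => adjacency_list G mu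
  | AdjacencyMatrix => adjacency_matrix G mu
  end.

(* The first two conditions say that words can hold every address of the input
   (both n + 6m and 2n^2 are at most (n + m + 2)^3) and every weight. *)
Definition solves_in_time (M : ram_algorithm) (f : input_form)
    (P : graph_problem) (t : nat -> nat -> nat) : Prop :=
  [/\ 3 <= word_const M, weight_const P <= word_const M
    & forall n m (G : graph n), problem_input P m G ->
      forall mu, represents f G mu ->
        let s := ram_run M n m (t m n) mu in
        halted (program M) s /\ out s = answer P G].

Definition word (b : nat) : Type := 'I_(2 ^ b).

(* A verifier with w words of b bits of working memory, for streams of edges on
   n vertices.  Each of its moves reads one fresh word of the private random
   string; only the memory kept between moves is bounded.  While reading the
   annotation, it may append words to a write-only output; in the end it either
   accepts this output as its value or outputs bottom. *)
Record verifier (n b w : nat) := Verifier {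
  v_start : word b -> w.-tuple (word b);
  v_stream : word b -> w.-tuple (word b) -> edge n -> w.-tuple (word b);
  v_annot : word b -> w.-tuple (word b) -> word b ->
            w.-tuple (word b) * option (word b);
  v_accept : w.-tuple (word b) -> bool
}.

(* Random strings for a stream of length m and an annotation of length l. *)
Definition coins (b m l : nat) : finType :=
  (word b * m.-tuple (word b) * l.-tuple (word b))%type.

Section Run.

Variables (n b w m : nat) (V : verifier n b w).
Variables (A : m.-tuple (edge n)) (a : seq (word b)).

Definition after_stream (rho : coins b m (size a)) : w.-tuple (word b) :=
  foldl (fun q x => v_stream V x.1 q x.2) (v_start V rho.1.1) (zip rho.1.2 A).

Definition after_annot (rho : coins b m (size a)) :
    w.-tuple (word b) * seq (word b) :=
  foldl (fun s x => let: (q, o) := v_annot V x.1 s.1 x.2 in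
                    (q, if o is Some y then rcons s.2 y else s.2))
        (after_stream rho, [::]) (zip rho.2 a).

(* [None] is bottom. *)
Definition output (rho : coins b m (size a)) : option (seq nat) :=
  let: (q, o) := after_annot rho in
  if v_accept V q then Some [seq val y | y <- o] else None.

End Run.

Definition prob (T : finType) (E : pred T) : rat := (#|E|%:R / #|T|%:R)%R.

Definition valid_on n b w m (V : verifier n b w) (A : m.-tuple (edge n))
    (a : seq (word b)) (y : seq nat) : Prop :=
  prob (fun rho : coins b m (size a) => output V A rho == Some y) = 1%R.

Definition third_invalid_on n b w m (V : verifier n b w) (A : m.-tuple (edge n))
    (a : seq (word b)) : Prop :=
  (prob (fun rho : coins b m (size a) => output V A rho != None) <= 1 / 3%:R)%R.

(* A helper is deterministic, and does not see the verifier's coins. *)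
Definition helper (n b m : nat) : Type := m.-tuple (edge n) -> seq (word b).

Section Protocol.

Variables (P : graph_problem) (n m b w : nat) (V : verifier n b w).

Definition valid_helper (H : helper n b m) : Prop :=
  forall A G, graph_stream P A G -> valid_on V A (H A) (answer P G).

Definition valid_protocol : Prop :=
  (exists H : helper n b m, valid_helper H) /\
  forall (H : helper n b m) A G, graph_stream P A G ->
    valid_on V A (H A) (answer P G) \/ third_invalid_on V A (H A).

Definition annotation_at_most (H : helper n b m) (L : nat) : Prop :=
  forall A G, graph_stream P A G -> size (H A) <= L.

Definition is_help_cost (L : nat) : Prop :=
  (exists2 H, valid_helper H & annotation_at_most H L) /\
  forall H L', valid_helper H -> annotation_at_most H L' -> L <= L'.

End Protocol.

(* Existence of an (h, v) protocol for P on graph streams; h and v are functions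
   of the number m of edges and the number n of vertices.  Costs are in words. *)
Definition has_protocol (P : graph_problem) (h v : nat -> nat -> nat) : Prop :=
  exists (c K : nat) (w : nat -> nat -> nat)
         (V : forall n m, verifier n (word_bits c n m) (w m n)),
    0 < c /\
    forall n m,
      [/\ valid_protocol P m (V n m),
          exists2 L, is_help_cost P m (V n m) L & L <= K * (h m n + 1)
        & w m n <= K * (v m n + 1)].

(* Main.v *)
(* The helper replays the run of the RAM and the verifier checks it by offline
   memory checking.  A multiset of (address, value, time) items is represented by
   the product of (r - e(item)) over a field F with 2 ^ b elements, for a secret
   random point r; two different multisets of size O(B) collide for O(B) of the
   2 ^ b points, where B bounds the words of the RAM.  Every memory access consumes
   the item of the last write to its cell, with a smaller time stamp, and writes a
   new item.  If finally each cell is dumped once (the dump is sorted by address,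
   so this is easy to enforce) and what was consumed equals what was written as a
   multiset, then every access returned the right value.

   Over a run of more than 2 ^ b steps such a product would be meaningless, so the
   run is cut into chunks of B steps.  The dump of a chunk is the initial memory of
   the next one, and its length is amortised by the B steps.  Only the cells touched
   so far are dumped, so that a run shorter than B costs O(m + t) and not O(B).

   A first chunk is used for the input: the helper repeats the arcs of the stream,
   sorted by source; the verifier compares this list with the stream as multisets and
   computes from it, one arc at a time, the cells of the chosen representation.
   Adjacency lists are thus those of the sorted order. *)
From HB Require Import structures.
Require Import Defs.
From mathcomp Require Import all_boot all_order all_algebra all_field zify.
From Stdlib Require Import FunctionalExtensionality ClassicalEpsilon.

Set Implicit Arguments.
Unset Strict Implicit.
Unset Printing Implicit Defensive.

(** * The checked RAM *)

(* (address, value, time) for memory cells, (source, target, weight) for arcs. *)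
Definition item : Type := (nat * nat * nat)%type.
Definition key (x : item) : nat := x.1.1.
Definition content (x : item) : nat := x.1.2.
Definition stamp (x : item) : nat := x.2.

(* [Exec fresh v k] is one step of the RAM; if it accesses a cell, the helper claims
   that this cell contains [v], last written at time [k], and [fresh] means that it
   was never touched and has to be created (with value 0) first.  [Final a v k] is
   the same claim about cell [a] at the end of a chunk. *)
Inductive message :=
| Arc (u v x : nat)
| Exec (fresh : bool) (v k : nat)
| Final (a v k : nat)
| Flush.

Record control := Control {
  running : bool;
  cpc : nat;
  cregs : nat -> nat;
  mark : option nat
}.

(* C is a type of multisets: sequences in the ideal run, field elements in the real
   one.  [mark] is the last source (first chunk) or the last address dumped, [carried]
   the initial memory of the next chunk, [clock] the time since the last flush. *)
Record state (C : Type) := State {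
  ctl : control;
  clock : nat;
  written : C;
  consumed : C;
  carried : C
}.

Section Machine.

Variables (f : input_form) (n B : nat) (p : seq instr).

(* The third cell is the one that points to node j: the next field of node j - 1 if
   that node has the same source, the head of the list of u otherwise. *)
Definition init_cells (q : option nat) (j : nat) (e : item) : seq item :=
  let: (u, v, x) := e in
  match f with
  | AdjacencyMatrix => [:: (u * n + v, 1, 0); (n * n + (u * n + v), x, 0)]
  | AdjacencyList =>
      [:: (n + 3 * j, v, 0); (n + 3 * j + 1, x, 0);
          (if q == Some u then n + 3 * j.-1 + 2 else u, n + 3 * j, 0)]
  end.

(** The cell touched and the value it holds afterwards, [v] being the claimed value before. A read
    puts its item back with a new stamp, so that reads and writes are treated alike. *)
Definition access (i : nat) (R : nat -> nat) (v : nat) : option (nat * nat) :=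
  match nth Halt p i with
  | Read _ a => Some (R a, v)
  | Write a r => Some (R a, R r)
  | _ => None
  end.

(** An instruction reads at most one cell, so a memory constantly equal to the claimed value stands
    in for the true one. *)
Definition blind_step (q : control) (v : nat) : config :=
  step B p (Config (cpc q) (cregs q) (fun=> v) [::]).

(** The triple lists the items to add to [written], [consumed] and [carried]. The test [k' <= k]
    forbids consuming an item that is only written later, [mark q == None] forbids execution once
    the dump has begun, and the increasing addresses let the dump list each cell at most once. *)
Definition control_step (q : control) (k : nat) (x : message) :
    option (control * (seq item * seq item * seq item) * option nat) :=
  match x with
  | Arc u v w =>
      if [&& ~~ running q, u < n, v < n & if mark q is Some u' then u' <= u else true]
      then Some (Control false (cpc q) (cregs q) (Some u),
                 ([::], [:: (u, v, w)], init_cells (mark q) k (u, v, w)), None)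
      else None
  | Exec fresh v k' =>
      if running q && (mark q == None) then
        let c := blind_step q v in
        let q' := Control true (pc c) (regs c) None in
        if access (cpc q) (cregs q) v is Some (a, w) then
          if (k' <= k) && (fresh ==> (v == 0) && (k' == 0)) then
            Some (q', (nseq fresh (a, v, k') ++ [:: (a, w, k.+1)], [:: (a, v, k')], [::]),
                  ohead (out c))
          else None
        else Some (q', ([::], [::], [::]), ohead (out c))
      else None
  | Final a v k' =>
      if running q && (if mark q is Some a' then a' < a else true) then
        Some (Control true (cpc q) (cregs q) (Some a),
              ([::], [:: (a, v, k')], [:: (a, v, 0)]), None)
      else None
  | Flush => None
  end.

Section Accumulator.

Variables (C : Type) (add : C -> seq item -> C) (emp : C) (same : C -> C -> bool).

(** The bound on the clock leaves room for [B] instructions and a dump of at most [B] cells; it also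
    bounds the multisets compared by a flush. *)
Definition mstep (s : state C) (x : message) : option (state C * option nat) :=
  if x is Flush then
    if same (written s) (consumed s) then
      Some (State (Control true (cpc (ctl s)) (cregs (ctl s)) None) 0
                  (carried s) emp emp, None)
    else None
  else if clock s < 2 * B then
    if control_step (ctl s) (clock s) x is Some (q, (l, r, c), o) then
      Some (State q (clock s).+1 (add (written s) l) (add (consumed s) r)
                  (add (carried s) c), o)
    else None
  else None.

Fixpoint run (s : state C) (xs : seq message) : option (state C * seq nat) :=
  if xs is x :: xs' then
    if mstep s x is Some (s', o) then
      if run s' xs' is Some (s'', o') then Some (s'', seq_of_opt o ++ o') else None
    else None
  else Some (s, [::]).

(** Clock 0 means that no message follows the last flush, so that every claim has been checked. *)
Definition accepting (s : state C) : bool :=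
  [&& running (ctl s), clock s == 0
    & if nth Halt p (cpc (ctl s)) is Halt then true else false].

Lemma run_cat (s : state C) (xs ys : seq message) :
  run s (xs ++ ys) =
  if run s xs is Some (s', o) then
    if run s' ys is Some (s'', o') then Some (s'', o ++ o') else None
  else None.
Proof.
elim: xs s => [|x xs IH] s /=; first by case: run => // -[].
case: mstep => // -[s1 o1]; rewrite IH; case: run => // -[s2 o2].
by case: run => // -[s3 o3]; rewrite catA.
Qed.

End Accumulator.

Lemma blind_out (q : control) (v : nat) :
  out (blind_step q v) = seq_of_opt (ohead (out (blind_step q v))).
Proof. by rewrite /blind_step /step /=; case: nth. Qed.

Lemma blind_stepE (q : control) (M : nat -> nat) (o : seq nat) (v : nat) :
  (forall a w, access (cpc q) (cregs q) v = Some (a, w) ->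
     v = M a) ->
  let c := blind_step q v in
  step B p (Config (cpc q) (cregs q) M o) =
  Config (pc c) (regs c)
    (if access (cpc q) (cregs q) v is Some (a, w) then [eta M with a |-> w] else M)
    (o ++ out c).
Proof.
rewrite /blind_step /step /access; case: nth => //=; rewrite ?cats0 //.
(* A read rewrites its cell with the value already there. *)
- move=> r a /(_ _ _ erefl) ->; congr Config.
  by apply: functional_extensionality => x /=; case: eqP => // ->.
- by move=> r; rewrite cats1.
Qed.

(** * Soundness of offline memory checking in the ideal run *)

Definition fits (M : nat -> nat) (L : seq item) : Prop :=
  [/\ forall x, x \in L -> stamp x = 0, forall x, x \in L -> content x = M (key x)
    & forall a, a \notin map key L -> M a = 0].

Variant second_phase (s : state (seq item)) (s' : state (seq item))
    (o : option nat) : Prop :=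
| SpCompute v of mark (ctl s) = None & access (cpc (ctl s)) (cregs (ctl s)) v = None
    & let c := blind_step (ctl s) v in
      s' = State (Control true (pc c) (regs c) None) (clock s).+1
                 (written s) (consumed s) (carried s) /\ o = ohead (out c)
| SpAccess v a w k (fresh : bool) of mark (ctl s) = None
    & access (cpc (ctl s)) (cregs (ctl s)) v = Some (a, w)
    & k <= clock s & (fresh -> v = 0 /\ k = 0)
    & let c := blind_step (ctl s) v in
      s' = State (Control true (pc c) (regs c) None) (clock s).+1
                 (written s ++ nseq fresh (a, v, k) ++ [:: (a, w, (clock s).+1)])
                 (consumed s ++ [:: (a, v, k)]) (carried s) /\ o = ohead (out c)
| SpDump a v k of (forall a', mark (ctl s) = Some a' -> a' < a)
    & s' = State (Control true (cpc (ctl s)) (cregs (ctl s)) (Some a)) (clock s).+1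
                 (written s) (consumed s ++ [:: (a, v, k)])
                 (carried s ++ [:: (a, v, 0)]) & o = None.

Notation istep := (mstep cat [::] (@perm_eq item)).

Lemma second_phaseP (s s' : state (seq item)) (x : message) (o : option nat) :
  x <> Flush -> running (ctl s) -> istep s x = Some (s', o) -> second_phase s s' o.
Proof.
move=> nF run_s; case: x nF => [u v w|fresh v k|a v k|] //= _.
- by case: ifP => //; rewrite run_s.
- case: ifP => // _; rewrite run_s /=; case: eqP => // mk.
  case E: access => [[a w]|] /=; last first.
    by move=> [<- <-]; apply: (SpCompute mk E); rewrite !cats0.
  case: ifP => // /andP[le_k fr] [<- <-].
  apply: (SpAccess mk E le_k _ (fresh := fresh)); last by rewrite !cats0.
  by move=> F; move: fr; rewrite F /= => /andP[/eqP-> /eqP->].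
- case: ifP => // _; rewrite run_s /=; case: ifP => // mk [<- <-].
  apply: (@SpDump _ _ _ a v k) => //; last by rewrite cats0.
  by move=> a' E; rewrite E in mk.
Qed.

Lemma second_phase_running (s s' : state (seq item)) (o : option nat) :
  second_phase s s' o -> running (ctl s').
Proof.
by case=> [v _ _ [-> _]|v a w k fresh _ _ _ _ [-> _]|a v k _ -> _].
Qed.

Definition initial (x : item) : bool := stamp x == 0.

(** The items that can still be written within the chunk: created cells, which hold 0, and items
    stamped after the present clock. *)
Definition later (s : state (seq item)) (x : item) : Prop :=
  (stamp x = 0 /\ content x = 0) \/ clock s < stamp x.

Definition extends (s s' : state (seq item)) : Prop :=
  exists l r, [/\ written s' = written s ++ l, consumed s' = consumed s ++ r,
    forall x, x \in l -> later s x, mark (ctl s) <> None -> l = [::]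
    & clock s <= clock s' ].

Lemma second_phase_extends (s s' s'' : state (seq item)) (o : option nat) :
  second_phase s s' o -> extends s' s'' -> extends s s''.
Proof.
move=> st [l [r [El Er hl ml le]]].
case: st El Er hl ml le =>
  [v mk E [-> _]|v a w k fresh mk E lek fr [-> _]|a v k mk -> _] /= El Er hl ml le.
- exists l, r; split => //; last exact: ltnW.
  by move=> x /hl [?|lt]; [left | right; apply: ltnW lt].
- exists (nseq fresh (a, v, k) ++ [:: (a, w, (clock s).+1)] ++ l), ((a, v, k) :: r); split.
  + by rewrite El -!catA.
  + by rewrite Er -!catA.
  + move=> x; rewrite !mem_cat mem_nseq mem_seq1 => /or3P[].
    * by case/andP; case: fresh fr {El hl} => // /(_ isT) [-> ->] _ /eqP->; left.
    * by move/eqP->; right.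
    * by move=> /hl [?|lt]; [left | right; apply: ltnW lt].
  + by rewrite mk.
  + exact: ltnW.
- exists l, ((a, v, k) :: r); split => //.
  + by rewrite Er -!catA.
  + by move=> x /hl [?|lt]; [left | right; apply: ltnW lt].
  + by move=> _; apply: ml.
  + exact: ltnW.
Qed.

Definition quiet (xs : seq message) : bool :=
  all (fun x => if x is Flush then false else true) xs.

Notation irun := (run cat [::] (@perm_eq item)).

Lemma run_step (s s' : state (seq item)) (x : message) (xs : seq message) (o : seq nat) :
  quiet (x :: xs) -> running (ctl s) -> irun s (x :: xs) = Some (s', o) ->
  exists s1 o1 o2, [/\ second_phase s s1 o1, running (ctl s1), quiet xs,
    irun s1 xs = Some (s', o2) & o = seq_of_opt o1 ++ o2].
Proof.
move=> /= /andP[nF q] run_s; case E: mstep => [[s1 o1]|] //.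
case E2: run => [[s2 o2]|] // [<- <-].
have st : second_phase s s1 o1 by apply: second_phaseP E => // xF; rewrite xF in nF.
by exists s1, o1, o2; split => //; apply: second_phase_running st.
Qed.

Lemma run_extends (xs : seq message) (s s' : state (seq item)) (o : seq nat) :
  quiet xs -> running (ctl s) -> irun s xs = Some (s', o) ->
  extends s s' /\ running (ctl s').
Proof.
elim: xs s o => [|x xs IH] s o.
  by move=> _ run_s [<- _]; split => //; exists [::], [::]; rewrite !cats0.
move=> q run_s /(run_step q run_s) [s1 [o1 [o2 [st r1 q1 /(IH _ _ q1 r1)[e r] _]]]].
by split => //; apply: second_phase_extends st e.
Qed.

Definition at_key (a : nat) : pred item := [pred x | key x == a].

(** The tally is a balance for each address: an access writes one item and consumes one, a creation
    writes one more, which is initial, and a dump consumes one item and carries one. The other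
    written items are distinct since their stamps increase strictly. *)
Record ledger (s : state (seq item)) : Prop := Ledger {
  ledger_tally : forall a,
    count (at_key a) (written s) + count (at_key a) (carried s) =
    count (at_key a) (consumed s) + count (at_key a) (filter initial (written s));
  ledger_carried : uniq (map key (carried s));
  ledger_mark : forall x, x \in carried s ->
    stamp x = 0 /\ exists2 a, mark (ctl s) = Some a & key x <= a;
  ledger_clock : forall x, x \in written s -> stamp x <= clock s;
  ledger_uniq : uniq (filter (predC initial) (written s))
}.

Lemma second_phase_ledger (s s' : state (seq item)) (o : option nat) :
  second_phase s s' o -> ledger s -> ledger s'.
Proof.
move=> st [tally uc mk cl uw].
case: st => [v mks E [-> _]|v a w k fresh mks E lek fr [-> _]|a v k mks -> _].
- split => //=; last by move=> x /cl /leqW.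
  by move=> x /mk [_ [a]]; rewrite mks.
- split => //=.
  + move=> b; rewrite !(filter_cat, count_cat) /= !addn0.
    have -> : filter initial (nseq fresh (a, v, k)) = nseq fresh (a, v, k).
      by case: fresh fr => // /(_ isT) [-> ->].
    have := tally b; move: (count _ (written s)) (count _ (carried s)) (count _ (consumed s)).
    move: (count _ (nseq _ _)) (count _ (filter _ _)) => c1 c2 c3 c4 c5.
    rewrite /key /=; case: (a == b) => /=; lia.
  + by move=> x /mk [_ [b]]; rewrite mks.
  + move=> x; rewrite !mem_cat mem_nseq mem_seq1 => /or3P[/cl /leqW //||/eqP-> //].
    by case/andP => _ /eqP -> /=; apply: leqW.
  + rewrite !filter_cat /= cat_uniq uw /=.
    have -> : filter (predC initial) (nseq fresh (a, v, k)) = [::].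
      by case: fresh fr => // /(_ isT) [-> ->].
    rewrite /= orbF andbT mem_filter negb_and orbC.
    by case H: (_ \in _) => //; have := cl _ H; rewrite /= ltnn.
- split => //=.
  + move=> b; rewrite !count_cat /=; have := tally b.
    move: (count _ (written s)) (count _ (carried s)) (count _ (consumed s)).
    move: (count _ (filter _ _)) => c1 c2 c3 c4.
    by rewrite /at_key /= /key /=; case: (a == b) => /=; lia.
  + rewrite map_cat cat_uniq uc /= orbF andbT.
    apply/mapP => -[x /mk [_ [b /mks lt le]] E].
    by move: E; rewrite /key /= => E; move: le; rewrite /key -E leqNgt lt.
  + move=> x; rewrite mem_cat mem_seq1 => /orP[/mk [-> [b /mks lt le]]|/eqP->].
      by split => //; exists a => //; apply: leq_trans le (ltnW lt).
    by split => //; exists a.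
  + by move=> x /cl /leqW.
Qed.

Lemma run_ledger (xs : seq message) (s s' : state (seq item)) (o : seq nat) :
  quiet xs -> running (ctl s) -> irun s xs = Some (s', o) -> ledger s -> ledger s'.
Proof.
elim: xs s o => [|x xs IH] s o; first by move=> _ _ [<- _].
move=> q run_s /(run_step q run_s) [s1 [o1 [o2 [st r1 q1 E _]]]] L.
by apply: IH E _ => //; apply: second_phase_ledger st L.
Qed.

Lemma ledger_init (q : control) (L : seq item) :
  (forall x, x \in L -> stamp x = 0) -> ledger (State q 0 L [::] [::]).
Proof.
move=> L0; have fL : filter initial L = L by apply/all_filterP/allP => x /L0 /eqP.
split => //= [a|x /L0 -> //|]; first by rewrite fL addn0.
by rewrite (eq_in_filter (a2 := pred0)) ?filter_pred0 // => x /L0 E; rewrite /= /initial E.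
Qed.

(** Once [written] and [consumed] cancel in the tally, each address has as many initial items as
    carried ones, that is at most one, because the dump has distinct addresses. So no cell is
    created twice. *)
Lemma ledger_settled (s : state (seq item)) :
  ledger s -> perm_eq (written s) (consumed s) ->
  perm_eq (map key (filter initial (written s))) (map key (carried s)) /\
  uniq (written s).
Proof.
move=> [tally uc mk cl uw] /permP pe.
have pk : perm_eq (map key (filter initial (written s))) (map key (carried s)).
  apply/allP => a _ /=; rewrite !count_map; apply/eqP.
  have cE L : count (preim key (pred1 a)) L = count (at_key a) L by apply: eq_count.
  have := tally a; rewrite !cE pe.
  by move/addnI->.
split => //; rewrite -(perm_uniq (permEl (perm_filterC initial _))) cat_uniq uw.
rewrite (map_uniq (f := key)) ?(perm_uniq pk) // andbT /=.
by apply/hasPn => x; rewrite !mem_filter /= => /andP[/negPf->].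
Qed.

(** [I] is meant to hold all initial items of the chunk, even those still to be created: a created
    cell counts as present from the start, with value 0. The live items, those not yet consumed,
    then describe the memory. *)
Record tracks (I : seq item) (s : state (seq item)) (M : nat -> nat) : Prop := Tracks {
  tracks_live : forall x, x \in I ++ written s -> x \notin consumed s ->
    content x = M (key x);
  tracks_one : forall x y, x \in I ++ written s -> x \notin consumed s ->
    y \in I ++ written s -> y \notin consumed s -> key x = key y -> x = y;
  tracks_zero : forall a, a \notin map key I -> M a = 0;
  tracks_known : forall x, x \in written s -> key x \in map key I;
  tracks_none : mark (ctl s) = None -> carried s = [::];
  tracks_carried : forall x, x \in carried s -> content x = M (key x)
}.

(** What is written after [s] is either initial or stamped after the clock of [s], so an item with
    an older stamp must be there already. *)
Lemma extends_old (s s' : state (seq item)) (x : item) :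
  extends s s' -> x \in written s' -> stamp x <= clock s ->
  x \in filter initial (written s') ++ written s.
Proof.
move=> [l [r [-> _ hl _ _]]] xw le; rewrite mem_cat mem_filter xw andbT.
rewrite /initial; case: (stamp x =P 0) => //= nz; move: xw; rewrite mem_cat => /orP[//|/hl [[//]|]].
by rewrite ltnNge le.
Qed.

(** Any item consumed is eventually among the written ones. Its stamp shows that it is there
    already, and it was not consumed before because the consumed items are distinct. So it is the
    one live item of its address, and the claimed value is the true content. *)
Lemma replay (xs : seq message) (s s' : state (seq item)) (o : seq nat) (M : nat -> nat)
    (o0 : seq nat) :
  quiet xs -> running (ctl s) -> irun s xs = Some (s', o) ->
  perm_eq (written s') (consumed s') -> uniq (written s') ->
  tracks (filter initial (written s')) s M ->
  exists T M',
    iter T (step B p) (Config (cpc (ctl s)) (cregs (ctl s)) M o0) =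
      Config (cpc (ctl s')) (cregs (ctl s')) M' (o0 ++ o) /\
    tracks (filter initial (written s')) s' M'.
Proof.
move=> q + + pe uw; have uc : uniq (consumed s') by rewrite -(perm_uniq pe).
set I := filter _ _.
elim: xs q s o M o0 => [|x xs IH] q s o M o0 run_s.
  by move=> [<- <-] tr; exists 0, M; rewrite cats0.
move=> /(run_step q run_s) [s1 [o1 [o2 [st r1 q1 E ->]]]] tr.
have [ext1 _] := run_extends q1 r1 E.
have ext := second_phase_extends st ext1.
have {}IH := IH q1 s1 o2 _ _ r1 E.
case: st ext1 IH r1 E =>
  [v mk Ea [-> ->]|v a w k fresh mk Ea lek fr [-> ->]|a v k mk -> ->] /= ext1 IH r1 E.
- have tr1 : tracks I (State (Control true (pc (blind_step (ctl s) v))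
      (regs (blind_step (ctl s) v)) None) (clock s).+1 (written s) (consumed s)
      (carried s)) M.
    by case: tr => *; split => //= _; auto.
  have [T [M' [ET tr']]] := IH M (o0 ++ out (blind_step (ctl s) v)) tr1.
  exists T.+1, M'; split => //; rewrite iterSr (@blind_stepE _ _ _ v) Ea //.
  by rewrite ET -blind_out -catA.
- pose y : item := (a, v, k).
  have [l1 [r [_ Er _ _ _]]] := ext1.
  have yR : y \in consumed s' by rewrite Er /= !mem_cat mem_seq1 eqxx orbT.
  have yI : y \in I ++ written s.
    by apply: (@extends_old _ _ y ext _ lek); rewrite (perm_mem pe).
  have yC : y \notin consumed s.
    move: uc; rewrite Er cat_uniq /= => /andP[+ _].
    by rewrite cat_uniq /= orbF andbT => /andP[_].
  have aI : a \in map key I.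
    move: yI; rewrite mem_cat => /orP[yI|/(tracks_known tr) //].
    by apply/mapP; exists y.
  have vM : v = M a by apply: (tracks_live tr yI yC).
  pose M1 := [eta M with a |-> w].
  set s1' := State _ _ _ _ _ in ext1 IH.
  have old z : z \in I ++ written s1' -> z \notin consumed s1' ->
      z = (a, w, (clock s).+1) \/
      [/\ z \in I ++ written s, z \notin consumed s & key z <> a].
    move=> zI zC; case: (z =P (a, w, (clock s).+1)) => [|nz]; [by left|right].
    move: zC; rewrite mem_cat negb_or mem_seq1 => /andP[zC zy].
    have zI' : z \in I ++ written s.
      move: zI; rewrite /= !mem_cat mem_nseq mem_seq1 => /or4P[->|->||/eqP//]; rewrite ?orbT //.
      by rewrite -/y (negPf zy) andbF.
    split => // kz; case/eqP: zy.
    exact: (tracks_one tr zI' zC yI yC).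
  have tr1 : tracks I s1' M1.
    split.
    + move=> z zI zC; have [->|[zI' zC' kz]] := old z zI zC.
        by rewrite /M1 /= eqxx.
      by rewrite /M1 /=; case: eqP => // _; apply: (tracks_live tr).
    + move=> z t zI zC tI tC; have := (old z zI zC, old t tI tC).
      case=> -[->|[zI' zC' kz]] [->|[tI' tC' kt]] //.
      * by move=> H; case: kt; rewrite -H.
      * exact: (tracks_one tr).
    + move=> b bI; rewrite /M1 /=; case: eqP => [ba|_]; last exact: (tracks_zero tr).
      by rewrite ba aI in bI.
    + move=> z; rewrite /= !mem_cat mem_nseq mem_seq1 => /or3P[/(tracks_known tr)//||/eqP-> //].
      by case/andP=> _ /eqP->.
    + by move=> _; apply: (tracks_none tr).
    + by move=> z; rewrite /= (tracks_none tr mk).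
  have [T [M' [ET tr']]] := IH M1 (o0 ++ out (blind_step (ctl s) v)) tr1.
  exists T.+1, M'; split => //; rewrite iterSr (@blind_stepE _ _ _ v) Ea //.
    by rewrite ET -blind_out -catA.
  by move=> ? ? [<- _].
- pose y : item := (a, v, k).
  have [l1 [r [El Er _ l0 _]]] := ext1.
  have yR : y \in consumed s' by rewrite Er /= !mem_cat mem_seq1 eqxx orbT.
  (* Nothing is written once the dump has begun, so an item consumed by the dump is already there
     whatever its stamp. *)
  have yI : y \in I ++ written s.
    rewrite mem_cat; apply/orP; right; move: yR; rewrite -(perm_mem pe) El /=.
    by rewrite l0 // cats0.
  have yC : y \notin consumed s.
    move: uc; rewrite Er cat_uniq /= => /andP[+ _].
    by rewrite cat_uniq /= orbF andbT => /andP[_].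
  have vM : v = M a by apply: (tracks_live tr yI yC).
  apply: (IH M o0); split => //=.
  + by move=> z zI; rewrite mem_cat negb_or => /andP[zC _]; apply: (tracks_live tr).
  + move=> z t zI; rewrite mem_cat negb_or => /andP[zC _] tI.
    by rewrite mem_cat negb_or => /andP[tC _]; apply: (tracks_one tr).
  + exact: (tracks_zero tr).
  + exact: (tracks_known tr).
  + move=> z; rewrite mem_cat mem_seq1 => /orP[/(tracks_carried tr)//|/eqP->//].
Qed.

Lemma uniq_map_inj (T1 T2 : eqType) (g : T1 -> T2) (L : seq T1) :
  uniq (map g L) -> {in L &, injective g}.
Proof.
elim: L => // x L IH /= /andP[xL uL] y z.
rewrite !inE => /predU1P[->|yL] /predU1P[->|zL] // E.
- by case/negP: xL; rewrite E map_f.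
- by case/negP: xL; rewrite -E map_f.
- exact: IH.
Qed.

(** A cell to be created lies outside [L], since the initial addresses are distinct; the memory is
    therefore 0 there, as the created item says. *)
Lemma tracks_init (q : control) (L l : seq item) (M : nat -> nat) :
  fits M L -> mark q = None -> (forall x, x \in l -> later (State q 0 L [::] [::]) x) ->
  uniq (map key (filter initial (L ++ l))) ->
  tracks (filter initial (L ++ l)) (State q 0 L [::] [::]) M.
Proof.
move=> [L0 LM Lz] mq hl.
have fL : filter initial L = L by apply/all_filterP/allP => x /L0 /eqP.
rewrite filter_cat fL => uI; set I := L ++ _ in uI *.
have II x : x \in I ++ L -> x \in I.
  by rewrite mem_cat => /orP[//|xL]; rewrite mem_cat xL.
split=> //=.
- move=> x /II; rewrite mem_cat mem_filter => /orP[/LM -> //|/andP[/eqP x0 xl]] _.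
  have [[_ ->]|] := hl x xl; last by rewrite x0.
  rewrite Lz //; apply/negP => kL; move: uI; rewrite map_cat cat_uniq => /and3P[_ /hasPn H _].
  by have := H (key x); rewrite kL map_f ?mem_filter ?xl /initial ?x0 // => /(_ isT).
- by move=> x y /II xI _ /II yI _; apply: (uniq_map_inj uI).
- move=> a; rewrite map_cat mem_cat negb_or => /andP[aL _]; exact: Lz.
- by move=> x xL; rewrite map_f // mem_cat xL.
Qed.

Lemma quiet_split (xs : seq message) :
  quiet xs \/ exists c r, quiet c /\ xs = c ++ Flush :: r.
Proof.
elim: xs => [|x xs IH]; first by left.
case E: (quiet [:: x]); last first.
  by right; exists [::], xs; case: x E.
case: IH => [q|[c [r [q ->]]]]; first by left; move: E; rewrite /= andbT => ->.
by right; exists (x :: c), r; split => //; move: E; rewrite /= andbT => ->.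
Qed.

Lemma run_clock (C : Type) (add : C -> seq item -> C) emp same (xs : seq message)
    (s s' : state C) (o : seq nat) :
  quiet xs -> run add emp same s xs = Some (s', o) -> clock s' = clock s + size xs.
Proof.
elim: xs s o => [|x xs IH] s o /=; first by move=> _ [<- _]; rewrite addn0.
case/andP=> nF q; case E: mstep => [[s1 o1]|] //.
case E1: run => [[s2 o2]|] // [E2 _]; move: E1; rewrite E2 => /(IH _ _ q) ->.
move: E; case: x nF => //= [? ? ?|? ? ?|? ? ?] _; case: ifP => // _;
  case: (if _ then _ else _) => [[[? [[? ?] ?]] ?]|] // [<- _] /=; lia.
Qed.

Lemma chunk_sound (q : control) (L : seq item) (M : nat -> nat) (o0 : seq nat)
    (xs : seq message) (s : state (seq item)) (o : seq nat) :
  quiet xs -> running q -> mark q = None -> fits M L ->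
  irun (State q 0 L [::] [::]) xs = Some (s, o) ->
  perm_eq (written s) (consumed s) ->
  exists T M', iter T (step B p) (Config (cpc q) (cregs q) M o0) =
      Config (cpc (ctl s)) (cregs (ctl s)) M' (o0 ++ o) /\ fits M' (carried s).
Proof.
move=> qx rq mq fM E pe.
have [L0 _ _] := fM.
have {}rq : running (ctl (State q 0 L [::] [::])) by [].
have ld := run_ledger qx rq E (ledger_init q L0).
have [pk uw] := ledger_settled ld pe.
have uI : uniq (map key (filter initial (written s))).
  by rewrite (perm_uniq pk) (ledger_carried ld).
have [[l [r [El _ hl _ _]]] _] := run_extends qx rq E.
rewrite /= in El; rewrite El in uI.
have tr := tracks_init fM mq hl uI; rewrite -El in tr.
have [T [M' [ET tr']]] := replay o0 qx rq E pe uw tr.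
exists T, M'; split => //; split.
- by move=> x /(ledger_mark ld)[].
- exact: (tracks_carried tr').
(* The dumped addresses are exactly those of the initial items, so a cell missing from the dump
   holds 0. *)
- by move=> a; rewrite -(perm_mem pk); apply: (tracks_zero tr').
Qed.

Lemma second_phase_sound (xs : seq message) (q : control) (L : seq item)
    (M : nat -> nat) (o0 : seq nat) (s : state (seq item)) (o : seq nat) :
  running q -> mark q = None -> fits M L ->
  irun (State q 0 L [::] [::]) xs = Some (s, o) -> accepting s ->
  exists T, let c := iter T (step B p) (Config (cpc q) (cregs q) M o0) in
    halted p c /\ out c = o0 ++ o.
Proof.
have [N] := ubnP (size xs); elim: N => // N IH in xs q L M o0 o *.
move=> le rq mq fM; case: (quiet_split xs) => [qx|[c [r [qc Exs]]]] E acc.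
  have := run_clock qx E; case/and3P: acc => _ /eqP -> h; case: xs {le qx} E => //=.
  by move=> [Es <-] _; exists 0; rewrite cats0 /halted /=; move: h; rewrite -Es /=; case: nth.
move: E le; rewrite Exs run_cat; case E: run => [[s1 o1]|] //=.
case: ifP => // pe; case E2: run => [[s2 o2]|] // [E3 Eo] le; rewrite {}E3 in E2.
have [T [M' [ET fM']]] := chunk_sound o0 qc rq mq fM E pe.
have := IH r _ (carried s1) M' (o0 ++ o1) o2 _ _ _ fM' E2 acc.
case=> //; first by move: le; rewrite size_cat /=; lia.
move=> T' H; exists (T' + T); rewrite iterD ET -Eo catA; exact: H.
Qed.

(** A halted configuration is a fixed point of [step]. Hence the number of steps replayed by a
    helper may differ from the running time without changing the result. *)
Lemma halted_unique (c : config) (T T' : nat) :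
  halted p (iter T (step B p) c) -> halted p (iter T' (step B p) c) ->
  iter T (step B p) c = iter T' (step B p) c.
Proof.
have stop c' k : halted p c' -> iter k (step B p) c' = c'.
  move=> h; elim: k => //= k ->; move: h; rewrite /halted /step.
  by case: c' => i R M o /= ->.
wlog le : T T' / T <= T' => [H|].
  by case/orP: (leq_total T T') => le ? ?; [|symmetry]; apply: H.
by move=> h _; rewrite -(subnK le) iterD (stop _ _ h).
Qed.
End Machine.

(** * Honest replays *)

Definition destination (i : instr) : nat :=
  match i with Const r _ | Op _ r _ _ | Read r _ => r | _ => 0 end.

Definition target (i : instr) : nat := if i is Jz _ l then l else 0.

(** A sum serves as a crude maximum, here and for [pc_bound]. The offset 2 covers the input
    registers 0 and 1. *)
Definition reg_bound (p : seq instr) : nat := (sumn (map destination p)).+2.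

Definition pc_bound (p : seq instr) : nat := (size p + sumn (map target p)).+1.

Lemma leq_sumn_nth (g : instr -> nat) (p : seq instr) (i : nat) :
  g Halt = 0 -> g (nth Halt p i) <= sumn (map g p).
Proof.
move=> g0; elim: p i => [|x p IH] [|i] //=; rewrite ?g0 ?leq_addr //.
by apply: leq_trans (IH i) _; rewrite leq_addl.
Qed.

(** This confines the control to a finite set that constantly many words can encode. [U] is [B] in
    an honest run, but [16 * B] against an arbitrary helper, whose claimed values end up in
    registers. *)
Definition fits_control (U : nat) (p : seq instr) (i : nat) (R : nat -> nat) : Prop :=
  [/\ i < pc_bound p, forall r, R r < U & forall r, reg_bound p <= r -> R r = 0].

Lemma step_mem_bounded (U B : nat) (p : seq instr) (c : config) :
  (forall r, regs c r < U) -> (forall x, Defs.mem c x < U) ->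
  forall x, Defs.mem (step B p c) x < U.
Proof.
case: c => i R M o /= HR HM x; case: nth => //= a r.
by case: eqP.
Qed.

Lemma step_fits_control (U B : nat) (p : seq instr) (c : config) :
  0 < B -> B <= U -> fits_control U p (pc c) (regs c) -> (forall x, Defs.mem c x < U) ->
  fits_control U p (pc (step B p c)) (regs (step B p c)).
Proof.
case: c => i R M o /= B0 BU [ip RU R0] MU.
have H1 := @leq_sumn_nth destination p i erefl.
have H2 := @leq_sumn_nth target p i erefl.
have H3 : nth Halt p i <> Halt -> i < size p.
  by move=> H; rewrite ltnNge; apply/negP => le; case: H; rewrite nth_default.
have up r v : destination (nth Halt p i) = r -> v < U -> nth Halt p i <> Halt ->
    fits_control U p i.+1 [eta R with r |-> v].
  move=> Er vU nH; split; first by rewrite ltnS (leq_trans (H3 nH)) ?leq_addr.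
    by move=> x /=; case: eqP.
  move=> x le /=; case: eqP => [xr|_]; last exact: R0.
  by move: le; rewrite xr -Er /reg_bound; lia.
have keep : nth Halt p i <> Halt -> fits_control U p i.+1 R.
  by move=> nH; split => //; rewrite ltnS (leq_trans (H3 nH)) ?leq_addr.
case E: (nth Halt p i) (up) (keep) H2 => [r v|f r x y|r a|a r|r l|r|] //= {}up {}keep H2.
- by apply: up => //; apply: leq_trans (ltn_pmod _ B0) BU.
- by apply: up => //; apply: leq_trans (ltn_pmod _ B0) BU.
- exact: up.
- exact: keep.
- case: ifP => _; last exact: keep.
  by split => //; rewrite ltnS (leq_trans H2) ?leq_addl.
- exact: keep.
Qed.

Section Honest.

Variables (f : input_form) (n B : nat) (p : seq instr).
Hypothesis B_gt0 : 0 < B.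

Notation istep := (mstep f n B p cat [::] (@perm_eq item)).
Notation irun := (run f n B p cat [::] (@perm_eq item)).

Definition small (U : nat) (x : message) : bool :=
  match x with
  | Arc u v w => [&& u < U, v < U & w < U]
  | Exec _ v k => (v < U) && (k < U)
  | Final a v k => [&& a < U, v < U & k < U]
  | Flush => true
  end.

Definition live (M lt : nat -> nat) (D : seq nat) : seq item :=
  [seq (a, M a, lt a) | a <- D].

(** [D] lists the cells that have an item, the only ones to be dumped. *)
Record sane (i : nat) (R M : nat -> nat) (D : seq nat) : Prop := Sane {
  sane_control : fits_control B p i R;
  sane_mem : forall x, M x < B;
  sane_uniq : uniq D;
  sane_addr : all (gtn B) D;
  sane_zero : forall a, a \notin D -> M a = 0
}.

Lemma sane_size (i : nat) (R M : nat -> nat) (D : seq nat) :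
  sane i R M D -> size D <= B.
Proof.
case=> _ _ uD /allP aD _; rewrite -(size_iota 0 B); apply: uniq_leq_size => // a /aD.
by rewrite mem_iota.
Qed.

Record honest (s : state (seq item)) (M lt : nat -> nat) (D : seq nat) : Prop := Honest {
  honest_running : running (ctl s);
  honest_mark : mark (ctl s) = None;
  honest_sane : sane (cpc (ctl s)) (cregs (ctl s)) M D;
  honest_live : perm_eq (written s) (consumed s ++ live M lt D);
  honest_stamp : forall a, a \in D -> lt a <= clock s
}.

Lemma live_ext (M M' lt lt' : nat -> nat) (D : seq nat) :
  {in D, M =1 M'} -> {in D, lt =1 lt'} -> live M lt D = live M' lt' D.
Proof. by move=> EM El; apply/eq_in_map => a aD; rewrite EM ?El. Qed.

Lemma access_lt (i : nat) (R : nat -> nat) (v U a w : nat) :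
  (forall r, R r < U) -> v < U -> access p i R v = Some (a, w) -> a < U /\ w < U.
Proof. by rewrite /access => RU vU; case: nth => // r b [<- <-]. Qed.

Lemma honest_step (s : state (seq item)) (M lt : nat -> nat) (D : seq nat) (o0 : seq nat)
    (c : config) :
  honest s M lt D -> clock s < 2 * B ->
  c = step B p (Config (cpc (ctl s)) (cregs (ctl s)) M o0) ->
  exists x s' o D' lt', [/\ istep s x = Some (s', o), small (16 * B) x,
    [/\ ctl s' = Control true (pc c) (regs c) None, clock s' = (clock s).+1 &
        carried s' = carried s],
    out c = o0 ++ seq_of_opt o & honest s' (Defs.mem c) lt' D' /\ size D' <= (size D).+1].
Proof.
case=> rs mk sa pe ls kB def_c.
have [okc MB uD aD zD] := sa.
have [_ RB _] := okc.
have okc' : fits_control B p (pc c) (regs c) by rewrite def_c; apply: step_fits_control.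
have MB' : forall x, Defs.mem c x < B by rewrite def_c; apply: step_mem_bounded.
(* Whether and where memory is accessed does not depend on the value read, so probing with 0 decides
   it. *)
case A: (access p (cpc (ctl s)) (cregs (ctl s)) 0) => [[a w0]|]; last first.
  pose q := Control true (pc c) (regs c) None.
  have cE := @blind_stepE B p (ctl s) M o0 0; rewrite A -def_c in cE.
  have {}cE := cE (fun _ _ H => ltac:(discriminate H)).
  exists (Exec false 0 0), (State q (clock s).+1 (written s) (consumed s) (carried s)),
    (ohead (out (blind_step B p (ctl s) 0))), D, lt; split => //.
  - by rewrite /= kB rs mk /= A /= !cats0 /q cE.
  - by rewrite /=; lia.
  - by rewrite cE /= -blind_out.
  - split => //; split => //=; rewrite ?cE //=.
      by move: okc' MB'; rewrite cE.
    by move=> b /ls /leqW.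
have [w A'] : exists w, access p (cpc (ctl s)) (cregs (ctl s)) (M a) = Some (a, w).
  by move: A; rewrite /access; case: nth => // r b [<- _]; eexists.
have [aB wB] := access_lt RB (MB a) A'.
have cE := @blind_stepE B p (ctl s) M o0 (M a); rewrite A' -def_c in cE.
have {}cE := cE ltac:(by move=> b u [<- _]); rewrite /= in cE.
have memE : Defs.mem c = [eta M with a |-> w] by rewrite cE.
pose lt' := [eta lt with a |-> (clock s).+1].
pose q := Control true (pc c) (regs c) None.
pose fr := a \notin D.
pose k := if fr then 0 else lt a.
have kc : k <= clock s by rewrite /k /fr; case: ifP => // /negbFE /ls.
pose D' := a :: rem a D.
have uD' : uniq D' by rewrite /= rem_uniq // mem_rem_uniqF.
have mD' b : (b \in D') = (b == a) || (b \in D).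
  by rewrite inE (mem_rem_uniq a uD) inE; case: (b == a).
have lE : live (Defs.mem c) lt' D' = (a, w, (clock s).+1) :: live M lt (rem a D).
  rewrite /= memE /= /lt' /= eqxx; congr cons.
  by apply: live_ext => b; rewrite mem_rem_uniq // inE /= => /andP[/negPf -> _].
exists (Exec fr (M a) k), (State q (clock s).+1
    (written s ++ nseq fr (a, M a, k) ++ [:: (a, w, (clock s).+1)])
    (consumed s ++ [:: (a, M a, k)]) (carried s)),
  (ohead (out (blind_step B p (ctl s) (M a)))), D', lt'; split => //.
- rewrite /= kB rs mk /= A' kc /=.
  have -> : fr ==> (M a == 0) && (k == 0).
    by apply/implyP => F; rewrite /k F zD ?eqxx.
  by rewrite !cats0 /q cE.
- by rewrite /=; have := MB a; lia.
- by rewrite cE /= -blind_out.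
- split; last first.
    rewrite /= ltnS; case aD': (a \in D); last by rewrite rem_id ?aD'.
    by rewrite size_rem // leq_pred.
  split => //=.
  + split => //; last first.
      move=> b; rewrite mD' negb_or memE /= => /andP[/negPf -> bD]; exact: zD.
    by apply/allP => b; rewrite mD' => /orP[/eqP->|/(allP aD)].
  + rewrite -[_ :: live _ _ _]/(live (Defs.mem c) lt' D') lE.
    have lD : perm_eq (written s ++ nseq fr (a, M a, k))
        (consumed s ++ (a, M a, k) :: live M lt (rem a D)).
      rewrite /k /fr; case aD': (a \in D) => /=; last first.
        by rewrite rem_id ?aD' // perm_catC /= perm_sym perm_catC /= perm_cons perm_catC perm_sym.
      rewrite cats0 (permPl pe) perm_cat2l.
      exact: (perm_map (fun b => (b, M b, lt b)) (perm_to_rem aD')).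
    rewrite catA (permPl (perm_cat lD (perm_refl _))) -!catA perm_cat2l /= perm_cons.
    by rewrite perm_catC.
  + by move=> b; rewrite mD' /lt' /=; case: eqP => //= _ /ls /leqW.
Qed.

Lemma honest_steps (T : nat) (s : state (seq item)) (M lt : nat -> nat) (D : seq nat)
    (o0 : seq nat) :
  honest s M lt D -> clock s + T <= 2 * B ->
  let c := iter T (step B p) (Config (cpc (ctl s)) (cregs (ctl s)) M o0) in
  exists xs s' o D' lt', [/\ irun s xs = Some (s', o), all (small (16 * B)) xs /\ size xs = T,
    [/\ ctl s' = Control true (pc c) (regs c) None, clock s' = clock s + T &
        carried s' = carried s],
    out c = o0 ++ o & honest s' (Defs.mem c) lt' D' /\ size D' <= size D + T].
Proof.
elim: T s M lt D o0 => [|T IH] s M lt D o0 h kB c.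
  exists [::], s, [::], D, lt; rewrite !addn0 cats0; split => //.
  rewrite /c /=; case: h => rs mk _ _ _; split=> //; move: rs mk.
  by case: (ctl s) => r i R q /= -> ->.
have k2 : clock s < 2 * B by lia.
have [x [s1 [o1 [D1 [lt1 [E sx [Ec Ek En] Eo [h1 le1]]]]]]] :=
  honest_step (o0 := o0) h k2 erefl.
set c1 := step _ _ _ in Ec Eo h1.
have Ec1 : Config (cpc (ctl s1)) (cregs (ctl s1)) (Defs.mem c1) (o0 ++ seq_of_opt o1) = c1.
  by rewrite Ec -Eo; case: (c1).
have [|xs [s2 [o2 [D2 [lt2]]]]] := IH s1 _ _ _ (o0 ++ seq_of_opt o1) h1; first by lia.
rewrite Ec1 => -[E2 [sxs szs] [Ec2 Ek2 En2] Eo2 [h2 le2]].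
rewrite /c iterSr; exists (x :: xs), s2, (seq_of_opt o1 ++ o2), D2, lt2; split => //.
- by rewrite /= E E2.
- by rewrite /= sx szs.
- by split => //; [rewrite Ek2 Ek addSnnS | rewrite En2].
- by rewrite Eo2 catA.
- by split => //; lia.
Qed.

Lemma honest_dump (D : seq nat) (M lt : nat -> nat) (s : state (seq item)) :
  running (ctl s) -> clock s + size D <= 2 * B -> sorted ltn D ->
  (forall a b, mark (ctl s) = Some a -> b \in D -> a < b) ->
  exists q, irun s [seq Final a (M a) (lt a) | a <- D] =
    Some (State (Control true (cpc (ctl s)) (cregs (ctl s)) q) (clock s + size D) (written s)
      (consumed s ++ live M lt D) (carried s ++ live M (fun=> 0) D), [::]).
Proof.
elim: D s => [|a D IH] s rs.
  move=> _ _ _; exists (mark (ctl s)); rewrite /= addn0 !cats0; move: rs.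
  by case: s => -[r i R q] k ? ? ? /= ->.
rewrite /= => kB so mk; have so' := path_sorted so.
rewrite (_ : clock s < 2 * B); last lia.
have -> : running (ctl s) && (if mark (ctl s) is Some a' then a' < a else true).
  rewrite rs /=; case E: (mark (ctl s)) => [a'|] //.
  by apply: (mk a' a E); rewrite mem_head.
case: (IH (State (Control true (cpc (ctl s)) (cregs (ctl s)) (Some a)) (clock s).+1
    (written s ++ [::]) (consumed s ++ [:: (a, M a, lt a)])
    (carried s ++ [:: (a, M a, 0)]))) => //=; first lia.
  move=> b b' [<-] bD; have /allP := order_path_min ltn_trans so; exact.
by move=> q ->; exists q; rewrite cats0 -!catA /= addSnnS.
Qed.

Lemma honest_chunk (T : nat) (q : control) (L : seq item) (M : nat -> nat) (D : seq nat)
    (o0 : seq nat) :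
  T <= B -> running q -> mark q = None -> sane (cpc q) (cregs q) M D ->
  perm_eq L (live M (fun=> 0) D) ->
  let c := iter T (step B p) (Config (cpc q) (cregs q) M o0) in
  exists xs o L' D', [/\
    irun (State q 0 L [::] [::]) xs =
      Some (State (Control true (pc c) (regs c) None) 0 L' [::] [::], o),
    all (small (16 * B)) xs /\ size xs = T + size D' + 1,
    out c = o0 ++ o,
    sane (pc c) (regs c) (Defs.mem c) D' /\ size D' <= size D + T
    & perm_eq L' (live (Defs.mem c) (fun=> 0) D')].
Proof.
move=> TB rq mq sa pL c.
have h0 : honest (State q 0 L [::] [::]) M (fun=> 0) D by split.
have [|xs [s [o [D1 [lt [E [sxs szs] [Ec Ek En] Eo [h le]]]]]]] := honest_steps (T := T) o0 h0.
  by rewrite /=; lia.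
rewrite -/c in Ec Eo h; rewrite /= add0n in Ek.
have [rs mk sa1 pe ls] := h.
pose D' := sort leq D1.
have pD : perm_eq D' D1 by rewrite perm_sort.
have sD : size D' = size D1 by apply: perm_size.
have sa' : sane (pc c) (regs c) (Defs.mem c) D'.
  case: sa1; rewrite Ec /= => h1 h2 h3 h4 h5; split=> //.
  - by rewrite (perm_uniq pD).
  - by rewrite (perm_all _ pD).
  - by move=> a; rewrite (perm_mem pD); apply: h5.
(* The dumped addresses are distinct and below [B], so at most [B] messages follow the [T <= B]
   steps and the clock stays within [2 * B]. *)
have sB := sane_size sa'.
have [||||q2 E2] := honest_dump (D := D') (Defs.mem c) lt (s := s).
- exact: rs.
- by rewrite Ek; lia.
- by rewrite ltn_sorted_uniq_leq (perm_uniq pD) (sane_uniq sa1) sort_sorted //; apply: leq_total.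
- by move=> a b; rewrite mk.
exists (xs ++ [seq Final a (Defs.mem c a) (lt a) | a <- D'] ++ [:: Flush]), o,
  (carried s ++ live (Defs.mem c) (fun=> 0) D'), D'.
split => //; last by rewrite En.
- rewrite run_cat E run_cat E2 /=.
  by rewrite (permPl pe) perm_cat2l perm_sym perm_map //= Ec /= !cats0.
- split; last by rewrite !size_cat size_map /= szs addnA.
  rewrite !all_cat sxs andbT all_map /=; apply/allP => a aD /=.
  case: sa' => _ mB _ /allP aB _; have := mB a; have := aB a aD.
  have := ls a; rewrite -(perm_mem pD) => /(_ aD) /=; lia.
- by split => //; rewrite sD.
Qed.

(* Chunks of B steps: a dump then costs no more than the chunk it follows, except
   for the cells that were there at the start. *)
Lemma honest_run (T : nat) (q : control) (L : seq item) (M : nat -> nat) (D : seq nat)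
    (o0 : seq nat) :
  running q -> mark q = None -> sane (cpc q) (cregs q) M D ->
  perm_eq L (live M (fun=> 0) D) ->
  let c := iter T (step B p) (Config (cpc q) (cregs q) M o0) in halted p c ->
  exists xs s o, [/\ irun (State q 0 L [::] [::]) xs = Some (s, o), accepting p s,
    all (small (16 * B)) xs, size xs <= size D + 4 * T + 1 & out c = o0 ++ o].
Proof.
have [N] := ubnP T; elim: N => // N IH in T q L M D o0 *.
move=> le rq mq sa pL c hc; case: (leqP T B) => TB.
  have [xs [o [L' [D' [E [sxs szs] Eo [sa' leD] pL']]]]] := honest_chunk o0 TB rq mq sa pL.
  eexists xs, _, o; split; [exact: E| |by []|lia|exact: Eo].
  by rewrite /accepting /=; move: hc; rewrite /halted => ->.
have [xs [o [L' [D' [E [sxs szs] Eo [sa' leD] pL']]]]] := honest_chunk o0 (leqnn B) rq mq sa pL.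
set c' := iter B _ _ in E Eo sa' pL'.
have Ec' : Config (pc c') (regs c') (Defs.mem c') (o0 ++ o) = c' by rewrite -Eo; case: (c').
have Ec : c = iter (T - B) (step B p) c' by rewrite /c' -iterD subnK // ltnW.
have := IH (T - B) (Control true (pc c') (regs c') None) L' (Defs.mem c') D' (o0 ++ o).
rewrite /= Ec' -Ec => /(_ _ _ _ _ pL' hc) []//; first by lia.
move=> ys [s [o2 [E2 acc sys szy Eo2]]].
exists (xs ++ ys), s, (o ++ o2); split => //.
- by rewrite run_cat E E2.
- by rewrite all_cat sxs sys.
(* This chunk takes at most [2 * B + 1] messages and its dump, as initial memory of the next one, is
   charged at most [B] more. The [4 * B] allowed for its [B] steps covers both, and [B >= 1] covers
   the second flush. *)
- by rewrite size_cat szs; have := sane_size sa'; lia.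
- by rewrite Eo2 catA.
Qed.

End Honest.

(** * Input representations *)

Definition lookup (N : seq item) (a : nat) : nat :=
  content (nth (0, 0, 0) N (find (at_key a) N)).

Lemma lookup_mem (N : seq item) (x : item) :
  uniq (map key N) -> x \in N -> lookup N (key x) = content x.
Proof.
move=> uN xN; have h : has (at_key (key x)) N by apply/hasP; exists x => //; apply/eqP.
have yN : nth (0, 0, 0) N (find (at_key (key x)) N) \in N by rewrite mem_nth // -has_find.
by rewrite /lookup; congr content; apply: (uniq_map_inj uN) => //; apply/eqP/(nth_find _ h).
Qed.

Lemma lookup_notin (N : seq item) (a : nat) : a \notin map key N -> lookup N a = 0.
Proof.
move=> aN; rewrite /lookup nth_default // leqNgt -has_find; apply: contra aN.
by case/hasP => x xN /= /eqP <-; apply: map_f.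
Qed.

Lemma fits_lookup (N : seq item) :
  uniq (map key N) -> (forall x, x \in N -> stamp x = 0) -> fits (lookup N) N.
Proof.
by move=> uN sN; split => // [x xN|a]; [rewrite lookup_mem | apply: lookup_notin].
Qed.

Lemma live_lookup (N : seq item) :
  uniq (map key N) -> (forall x, x \in N -> stamp x = 0) ->
  live (lookup N) (fun=> 0) (map key N) = N.
Proof.
move=> uN sN; rewrite /live -map_comp -[RHS]map_id; apply/eq_in_map => -[[a b] c] xN /=.
by rewrite (lookup_mem uN xN); have := sN _ xN; rewrite /stamp /= => ->.
Qed.

(** * The first chunk: from sorted arcs to memory cells *)

Section FirstPhase.

Variables (f : input_form) (n B : nat) (p : seq instr).

Notation irun := (run f n B p cat [::] (@perm_eq item)).
Notation istep := (mstep f n B p cat [::] (@perm_eq item)).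

Fixpoint cells (q : option nat) (j : nat) (es : seq item) : seq item :=
  if es is e :: es' then init_cells f n q j e ++ cells (Some (key e)) j.+1 es' else [::].

Definition arc_message (e : item) : message := Arc (key e) (content e) (stamp e).

Definition in_graph (e : item) : bool := (key e < n) && (content e < n).

Fixpoint final_mark (q : option nat) (es : seq item) : option nat :=
  if es is e :: es' then final_mark (Some (key e)) es' else q.

Definition ordered (q : option nat) (es : seq item) : bool :=
  sorted leq (seq_of_opt q ++ map key es).

Lemma ordered_cons (q : option nat) (e : item) (es : seq item) :
  ordered q (e :: es) =
  (if q is Some u then u <= key e else true) && ordered (Some (key e)) es.
Proof. by case: q. Qed.

Lemma first_run (es : seq item) (s : state (seq item)) :
  ~~ running (ctl s) -> clock s + size es <= 2 * B -> all in_graph es ->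
  ordered (mark (ctl s)) es ->
  irun s (map arc_message es) =
    Some (State (Control false (cpc (ctl s)) (cregs (ctl s)) (final_mark (mark (ctl s)) es))
      (clock s + size es) (written s) (consumed s ++ es)
      (carried s ++ cells (mark (ctl s)) (clock s) es), [::]).
Proof.
elim: es s => [|e es IH] s rs kB.
  by rewrite /= addn0 !cats0; move: rs; case: s kB => -[[] i R q] k w c d.
move=> /= /andP[/andP[u v] aes]; rewrite ordered_cons => /andP[qe oes].
have kB' : clock s < 2 * B by move: kB; rewrite /=; lia.
rewrite kB' rs u v qe /= IH //=; last by move: kB; rewrite /=; lia.
by rewrite addSnnS cats0 -!catA /=; case: e {kB u v oes qe} => -[u v] x.
Qed.

(** Until the first flush [running] is false, which lets only arcs pass. *)
Lemma first_run_inv (xs : seq message) (s s' : state (seq item)) (o : seq nat) :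
  quiet xs -> ~~ running (ctl s) -> irun s xs = Some (s', o) ->
  exists2 es, xs = map arc_message es & [/\ clock s + size es <= 2 * B \/ es = [::],
    all in_graph es & ordered (mark (ctl s)) es].
Proof.
elim: xs s o => [|x xs IH] s o; first by exists [::] => //; split; [right | | case: mark].
case/andP=> nF qx rs /=; case E: mstep => [[s1 o1]|] //.
case E1: run => [[s2 o2]|] // [E2 _]; rewrite {}E2 in E1.
move: E; case: x nF => [u v w|fresh v k|a v k|] //= _; last 2 first.
- by case: ifP => // _; rewrite (negPf rs).
- by case: ifP => // _; rewrite (negPf rs).
case: ifP => // kB; case: ifP => // /and4P[_ un vn mk] [Es _].
have [|es -> []] := IH _ _ qx _ E1; first by rewrite -Es.
rewrite -Es /= => le aes oes; exists ((u, v, w) :: es) => //; split.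
- by left; case: le => [|->]; rewrite /=; lia.
- by rewrite /= aes /in_graph /key /content /= un vn.
- by rewrite ordered_cons oes andbT.
Qed.

Lemma cells_stamp (q : option nat) (j : nat) (es : seq item) (x : item) :
  x \in cells q j es -> stamp x = 0.
Proof.
elim: es q j => //= -[[u v] w] es IH q j; rewrite mem_cat => /orP[|/IH //].
by rewrite /init_cells; case: f; rewrite !inE; [case/or3P => /eqP-> | case/orP => /eqP->].
Qed.

End FirstPhase.

Definition arc_item n (a : edge n) : item := (val a.1.1, val a.1.2, a.2).

Lemma arc_item_inj n : injective (@arc_item n).
Proof. by move=> [[u v] x] [[u' v'] x'] [/val_inj -> /val_inj -> ->]. Qed.

Lemma enumerates_perm n (s t : seq (edge n)) (G : graph n) :
  perm_eq s t -> enumerates t G -> enumerates s G.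
Proof.
by move=> st [u m]; split=> [|a]; [rewrite (perm_uniq (perm_map _ st)) | rewrite (perm_mem st)].
Qed.

Lemma map_image (T : Type) (T' : eqType) (g : T -> T') (L : seq T') :
  (forall x, x \in L -> exists a, x = g a) -> exists s, L = map g s.
Proof.
elim: L => [|x L IH] H; first by exists [::].
have [a ->] := H x (mem_head _ _).
have [|s ->] := IH; first by move=> y yL; apply: H; rewrite inE yL orbT.
by exists (a :: s).
Qed.

Lemma row_major_inj (n u v u' v' : nat) :
  v < n -> v' < n -> u * n + v = u' * n + v' -> u = u' /\ v = v'.
Proof.
move=> vn vn' E; have n0 : 0 < n by lia.
split; [have := congr1 (divn^~ n) E | have := congr1 (modn^~ n) E].
  by rewrite !divnMDl // !divn_small // !addn0.
by rewrite !modnMDl !modn_small.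
Qed.

Lemma row_major_lt (n u v : nat) : u < n -> v < n -> u * n + v < n * n.
Proof. nia. Qed.

Lemma in_graph_arcs n (s : seq (edge n)) : all (in_graph n) (map (@arc_item n) s).
Proof. by apply/allP => _ /mapP[a _ ->]; rewrite /in_graph /key /content /= !ltn_ord. Qed.

Section Matrix.

Variable n : nat.

Notation mcells := (cells AdjacencyMatrix n).

Lemma matrix_cellsP (q : option nat) (j : nat) (es : seq item) (x : item) :
  reflect (exists2 e, e \in es & x = (key e * n + content e, 1, 0) \/
             x = (n * n + (key e * n + content e), stamp e, 0))
    (x \in mcells q j es).
Proof.
apply: (iffP idP); elim: es q j => [|[[u v] w] es IH] q j /=.
- by [].
- rewrite !inE => /or3P[/eqP->|/eqP->|/IH[e ees H]].
  + by exists (u, v, w); [rewrite mem_head | left].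
  + by exists (u, v, w); [rewrite mem_head | right].
  + by exists e => //; rewrite inE ees orbT.
- by case.
- case=> e; rewrite !inE => /predU1P[-> [] ->|ees H]; rewrite ?eqxx ?orbT //.
  by rewrite IH ?orbT //; exists e.
Qed.

(** Distinct arcs have distinct row-major positions below [n * n], and the weights are shifted by
    [n * n], clear of the 0/1 matrix. *)
Lemma matrix_cells_uniq (q : option nat) (j : nat) (es : seq item) :
  all (in_graph n) es -> uniq [seq e.1 | e <- es] -> uniq (map key (mcells q j es)).
Proof.
elim: es q j => //= -[[u v] w] es IH q j /andP[/andP[un vn] aes] /andP[nes ues] /=.
rewrite /key /content /= in un vn.
have lt := row_major_lt un vn.
have far : forall y, y \in mcells (Some u) j.+1 es ->
    key y <> u * n + v /\ key y <> n * n + (u * n + v).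
  move=> y /matrix_cellsP[[[u' v'] w'] ees Ey].
  have /andP[un' vn'] := allP aes _ ees; rewrite /key /content /= in un' vn'.
  have lt' := row_major_lt un' vn'.
  have ne : u' * n + v' <> u * n + v.
    case/(row_major_inj vn' vn) => Eu Ev; case/negP: nes; apply/mapP.
    by exists (u', v', w') => //=; rewrite Eu Ev.
  by case: Ey => ->; rewrite /key /content /=; split => //; try (by move/addnI); lia.
rewrite IH // andbT; apply/andP; split.
  rewrite inE negb_or; apply/andP; split; first by rewrite /key /=; apply/eqP; lia.
  by apply/mapP => -[y /far [H _] E]; case: H; rewrite -E.
by apply/mapP => -[y /far [_ H] E]; case: H; rewrite -E.
Qed.

Lemma matrix_uniq (s : seq (edge n)) (G : graph n) (q : option nat) (j : nat) :
  enumerates s G -> uniq (map key (mcells q j (map (@arc_item n) s))).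
Proof.
move=> [us _]; apply: matrix_cells_uniq; first exact: in_graph_arcs.
rewrite -map_comp.
rewrite (_ : _ \o _ = (fun a : 'I_n * 'I_n => (val a.1, val a.2)) \o fst) // map_comp.
by rewrite map_inj_uniq // => -[u v] [u' v'] [/val_inj -> /val_inj ->].
Qed.

Lemma matrix_represents (s : seq (edge n)) (G : graph n) :
  enumerates s G -> adjacency_matrix G (lookup (mcells None 0 (map (@arc_item n) s))).
Proof.
move=> en; set N := mcells _ _ _.
have ag := in_graph_arcs s.
have uN : uniq (map key N) := matrix_uniq None 0 en.
have [us ms] := en.
have inN u v x : G (u, v) = Some x ->
    (u * n + v, 1, 0) \in N /\ (n * n + (u * n + v), x, 0) \in N.
  move=> Guv; have es : arc_item ((u, v), x) \in map (@arc_item n) s.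
    by rewrite map_f // ms Guv.
  by split; apply/matrix_cellsP; eexists; try exact: es; [left | right].
have notin (u v : 'I_n) a : G (u, v) = None ->
    a = u * n + v \/ a = n * n + (u * n + v) -> a \notin map key N.
  move=> Guv Ea; apply/mapP => -[y /matrix_cellsP[_ /mapP[[[u' v'] x] aes ->] Ey] Eya].
  have lt := row_major_lt (ltn_ord u) (ltn_ord v).
  have lt' := row_major_lt (ltn_ord u') (ltn_ord v').
  move: Ey; rewrite /key /content /= => Ey.
  have E : u' * n + v' = u * n + v.
    by move: Eya Ea; case: Ey => -> ->; rewrite /key /= => -[]; lia.
  have [/val_inj Eu /val_inj Ev] := row_major_inj (ltn_ord v') (ltn_ord v) E.
  by move: aes; rewrite ms /= Eu Ev Guv.
split=> [u v|u v|a le].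
- case Guv: (G (u, v)) => [x|] /=.
    by have [h _] := inN _ _ _ Guv; rewrite -[LHS]/(lookup N (key (u * n + v, 1, 0))) lookup_mem.
  by rewrite lookup_notin //; apply: notin Guv _; left.
- case Guv: (G (u, v)) => [x|] /=.
    have [_ h] := inN _ _ _ Guv.
    by rewrite -[LHS]/(lookup N (key (n * n + (u * n + v), x, 0))) lookup_mem.
  by rewrite lookup_notin //; apply: notin Guv _; right.
- rewrite lookup_notin //; apply/mapP => -[y /matrix_cellsP[e ees Ey] Ea].
  have /andP[/row_major_lt H /H lt] := allP ag _ ees.
  by move: Ea le; case: Ey => -> ->; rewrite /key /=; move: lt; rewrite /key /content; lia.
Qed.

End Matrix.

Section List.

Variable n : nat.

Notation lcells := (cells AdjacencyList n).
Notation x0 := ((0, 0, 0) : item).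

Definition previous (q : option nat) (es : seq item) (i : nat) : option nat :=
  if i is i'.+1 then Some (key (nth x0 es i')) else q.

Lemma list_cellsP (q : option nat) (j : nat) (es : seq item) (x : item) :
  reflect (exists2 i, i < size es &
      x \in init_cells AdjacencyList n (previous q es i) (j + i) (nth x0 es i))
    (x \in lcells q j es).
Proof.
apply: (iffP idP); elim: es q j => [|e es IH] q j.
- by [].
- rewrite mem_cat => /orP[H|/IH[i lt H]]; first by exists 0; rewrite ?addn0.
  by exists i.+1 => //; rewrite -addSnnS; move: H; case: (i).
- by case.
- rewrite mem_cat => -[[|i] lt H]; first by rewrite addn0 in H; rewrite H.
  by rewrite IH ?orbT //; exists i => //; rewrite addSnnS; move: H; case: (i).
Qed.

(** After node [j], of source [u], the cells to come are heads of larger sources and fields from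
    [n + 3 * j + 2] on. That cell, the next pointer of node [j], is included because node [j.+1] may
    continue the list of [u]. *)
Lemma list_cells_key (u j : nat) (es : seq item) (x : item) :
  ordered (Some u) es -> x \in lcells (Some u) j.+1 es ->
  u < key x < n \/ n + 3 * j + 2 <= key x \/ n <= u \/ ~~ all (in_graph n) es.
Proof.
elim: es u j => // -[[u' v] w] es IH u j; rewrite ordered_cons /= => /andP[le oes].
case aes: (all _ es); last by rewrite andbF; right; right; right.
rewrite /in_graph /key /content /= andbT in le *.
case un: (u' < n); last by right; right; right.
rewrite !inE => /or4P[/eqP->|/eqP->|/eqP->|/(IH _ _ oes)[]] /=.
- by right; left; lia.
- by right; left; lia.
- case: eqP => [_|ne] /=; first by right; left; lia.
  by left; rewrite un andbT; have : u <> u' by [move=> E; case: ne; rewrite E]; lia.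
- by rewrite /key /=; lia.
- by rewrite aes /key /=; lia.
Qed.

(** Each new node fills two fields of its own and one pointer that was left open. A previous source
    requires [0 < j], so that [j.-1] is a true predecessor and not node 0 itself. *)
Lemma list_cells_uniq (q : option nat) (j : nat) (es : seq item) :
  all (in_graph n) es -> ordered q es -> (q <> None -> 0 < j) ->
  uniq (map key (lcells q j es)).
Proof.
elim: es q j => //= -[[u v] w] es IH q j /andP[/andP[un vn] aes].
rewrite ordered_cons => /andP[qu oes] qj.
have far y : y \in lcells (Some u) j.+1 es -> u < key y < n \/ n + 3 * j + 2 <= key y.
  move=> /(list_cells_key oes) []; first by left.
  by rewrite aes; move: un; rewrite /key /= => un [|[]] //; [right | lia].
rewrite /= IH // andbT {IH oes}.
have nin a : ~ (u < a < n \/ n + 3 * j + 2 <= a) -> a \notin map key (lcells (Some u) j.+1 es).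
  by move=> na; apply/mapP => -[y /far H E]; apply: na; rewrite E.
have un' : u < n := un.
rewrite !inE !negb_or /= {far}; set a3 := key (if _ then _ else _, _, _).
have a3E : a3 = u \/ (a3 = n + 3 * j.-1 + 2 /\ 0 < j).
  by rewrite /a3 /key /=; case: eqP => [E|_]; [right; rewrite qj ?E | left].
rewrite /key /= in a3E *; rewrite !nin /=; lia.
Qed.

Lemma ordered_nth (es : seq item) (i j : nat) :
  ordered None es -> i <= j < size es -> key (nth x0 es i) <= key (nth x0 es j).
Proof.
rewrite /ordered /= => so /andP[le lt].
have := sorted_leq_nth leq_trans leqnn 0 so i j.
rewrite !inE size_map lt (leq_ltn_trans le lt) => /(_ isT isT le).
by rewrite !(nth_map x0) // (leq_ltn_trans le lt).
Qed.

Lemma node_ptrE (s : seq (edge n)) (u : 'I_n) (k : nat) :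
  let es := map (@arc_item n) s in
  let j := k + find (at_key u) (drop k es) in
  node_ptr s u k = if j < size es then n + 3 * j else 0.
Proof. by rewrite /node_ptr -map_drop find_map size_map. Qed.

(** Sorting by source makes the arcs of a vertex consecutive. The pointer to a node thus lies in the
    preceding node or in a list head, and the preceding source tells which. *)
Lemma list_represents (s : seq (edge n)) (G : graph n) :
  let es := map (@arc_item n) s in
  enumerates s G -> ordered None es ->
  adjacency_list G (lookup (lcells None 0 es)).
Proof.
move=> es; have Ees : es = map (@arc_item n) s by []; have szes : size es = size s.
  by rewrite Ees size_map.
clearbody es => en so; set N := lcells _ _ _.
have ag : all (in_graph n) es by rewrite Ees; apply: in_graph_arcs.
have uN : uniq (map key N) by apply: list_cells_uniq.
have inN x : x \in N -> lookup N (key x) = content x by apply: lookup_mem.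
have srcn i : i < size es -> key (nth x0 es i) < n.
  by move=> lt; have /allP/(_ _ (mem_nth x0 lt))/andP[] := ag.
have nodeP i : i < size es -> [/\
    lookup N (n + 3 * i) = content (nth x0 es i),
    lookup N (n + 3 * i + 1) = stamp (nth x0 es i) &
    lookup N (if previous None es i == Some (key (nth x0 es i)) then n + 3 * i.-1 + 2
              else key (nth x0 es i)) = n + 3 * i].
  move=> lt; case E: (nth x0 es i) => [[u v] w] /=.
  pose q := previous None es i.
  have sub : {subset init_cells AdjacencyList n q i (u, v, w) <= N}.
    by move=> x xI; apply/list_cellsP; exists i => //; rewrite E.
  split; [apply: (inN (n + 3 * i, v, 0)) | apply: (inN (n + 3 * i + 1, w, 0)) |
          apply: (inN (if q == Some u then n + 3 * i.-1 + 2 else u, n + 3 * i, 0))];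
  by apply: sub; rewrite !inE eqxx ?orbT.
have keyP a : a \in map key N -> exists2 i, i < size es &
    [\/ a = n + 3 * i, a = n + 3 * i + 1 |
        a = if previous None es i == Some (key (nth x0 es i)) then n + 3 * i.-1 + 2
              else key (nth x0 es i)].
  case/mapP => x /list_cellsP[i lt H ->]; exists i => //; move: H.
  case E: (nth x0 es i) => [[u v] w]; rewrite /= !inE.
  by case/or3P => /eqP ->; [constructor 1 | constructor 2 | constructor 3].
exists s => //; split.
- move=> u; rewrite node_ptrE -Ees drop0 add0n; case: ifP => lt.
    have := lt; rewrite -has_find => /(nth_find x0) /eqP Ek.
    have [_ _] := nodeP _ lt; rewrite Ek.
    (* The first arc of source [u] has no predecessor of the same source, so the cell pointing to it
       is the list head. *)
    case E: (find _ _) => [|i] //=; case: eqP => // -[Ei] _.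
    have : (key (nth x0 es i) == u) = false by apply: (@before_find _ x0 (at_key u)); rewrite E.
    by rewrite Ei eqxx.
  rewrite lookup_notin //; apply/negP => /keyP[i lti H].
  have ne : key (nth x0 es i) != u.
    by move/negbT: lt; rewrite -has_find => /hasPn/(_ _ (mem_nth x0 lti)).
  have := ltn_ord u; case: H => [||E]; try lia.
  by move: E; case: ifP => _ E; [lia | rewrite -E eqxx in ne].
- move=> i a Ea; have lt : i < size es by rewrite szes -onthTE Ea.
  have En : nth x0 es i = arc_item a.
    by rewrite Ees; apply: onth_nth; rewrite onth_map Ea.
  have [H1 H2 _] := nodeP i lt; rewrite H1 H2 En; split => //.
  rewrite node_ptrE -Ees; case: ifP => lt2.
    have hf : has (at_key a.1.1) (drop i.+1 es).
      by rewrite has_find size_drop; lia.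
    have Ek := nth_find x0 hf; rewrite nth_drop /= in Ek.
    set k := find _ _ in Ek lt2 *.
    (* If the next arc of this source were further on, the arc right after [i] would have the same
       source by sortedness. *)
    have k0 : k = 0.
      case Ek0: k => [|k'] //; have := @before_find _ x0 (at_key a.1.1) (drop i.+1 es) 0.
      rewrite -/k Ek0 nth_drop addn0 /= => /(_ isT) /eqP [].
      apply/eqP; rewrite eqn_leq -{1}(eqP Ek) ordered_nth //=; last by lia.
      by rewrite -[val a.1.1]/(key (arc_item a)) -En ordered_nth //; lia.
    rewrite k0 addn0 in Ek lt2 *; have [_ _] := nodeP i.+1 lt2.
    by rewrite /= En (eqP Ek) eqxx.
  (* An item at this next pointer could only come from node [i.+1] with the same source, and then
     the search would have succeeded. *)
  rewrite lookup_notin //; apply/negP => /keyP[i' lti' H].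
  case: H => [||E]; try lia.
  move: E; case: eqP => [Ep|_ E]; last by have := srcn _ lti'; lia.
  move=> E; have ii' : i'.-1 = i by lia.
  case: i' Ep lti' E ii' => // i' [Ep] lti' _ /= Ei; rewrite Ei in Ep lti'.
  have hf : has (at_key a.1.1) (drop i.+1 es).
    apply/hasP; exists (nth x0 es i.+1).
      have -> : nth x0 es i.+1 = nth x0 (drop i.+1 es) 0 by rewrite nth_drop addn0.
      by rewrite mem_nth // size_drop subn_gt0.
    by rewrite -[at_key _ _]/(key _ == _) -Ep En /=.
  by move: lt2; rewrite has_find size_drop in hf; lia.
- move=> a le; rewrite lookup_notin //; apply/negP => /keyP[i lti H].
  rewrite -szes in le; case: H; try lia.
  move=> E; have := srcn i; move=> /(_ lti); move: E; case: ifP => _; lia.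
Qed.

End List.

Lemma cells_represent f n (s : seq (edge n)) (G : graph n) :
  let es := map (@arc_item n) s in
  enumerates s G -> ordered None es ->
  uniq (map key (cells f n None 0 es)) /\ represents f G (lookup (cells f n None 0 es)).
Proof.
case: f => es en so; split; rewrite /represents.
- by apply: list_cells_uniq => //; apply: in_graph_arcs.
- exact: list_represents.
- exact: matrix_uniq en.
- exact: matrix_represents.
Qed.

Lemma cells_bounded f n (es : seq item) (U : nat) (q : option nat) (j : nat) (x : item) :
  all (in_graph n) es -> (forall e, e \in es -> stamp e < U) ->
  1 < U -> n + 3 * (j + size es) <= U -> 2 * (n * n) <= U ->
  x \in cells f n q j es -> key x < U /\ content x < U.
Proof.
move=> + + U1 + n2; elim: es q j => // -[[u v] w] es IH q j.
move=> /andP[/andP[un vn] aes] wU le; rewrite mem_cat => /orP[|]; last first.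
  apply: IH => //; first by move=> e ees; apply: wU; rewrite inE ees orbT.
  by move: le; rewrite /=; lia.
have := wU _ (mem_head _ _); rewrite /stamp /= in le * => wlt.
rewrite /key /content /= in un vn.
have lt := row_major_lt un vn.
rewrite /init_cells /key /content; case: f {IH}; rewrite !inE.
  case/or3P => /eqP-> /=; try (split; lia).
  by case: eqP; split; lia.
by case/orP => /eqP-> /=; split; lia.
Qed.

Lemma size_cells f n (es : seq item) (q : option nat) (j : nat) :
  size (cells f n q j es) <= 3 * size es.
Proof.
elim: es q j => // -[[u v] w] es IH q j; rewrite /= size_cat.
by have := IH (Some (key (u, v, w))) j.+1; case: f {IH} => /=; lia.
Qed.

Lemma size_arcs dir n (A : seq (edge n)) : size (arcs dir A) <= 2 * size A.
Proof.
rewrite /arcs; elim: A => //= a A IH; rewrite size_cat; case: ifP => _ /=; lia.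
Qed.

Definition stream_items dir n (A : seq (edge n)) : seq item := map (@arc_item n) (arcs dir A).

Definition start_control (n m : nat) : control :=
  Control false 0 (regs (ram_init n m (fun=> 0))) None.

(** * Soundness and completeness of the ideal protocol *)

Section Algorithm.

Variables (P : graph_problem) (M : ram_algorithm) (f : input_form) (t : nat -> nat -> nat).
Hypothesis hM : solves_in_time M f P t.
Variables (n m : nat) (A : m.-tuple (edge n)) (G : graph n).
Hypothesis hA : graph_stream P A G.

Let B := 2 ^ word_bits (word_const M) n m.
Let p := program M.

Notation irun := (run f n B p cat [::] (@perm_eq item)).
Notation start := (State (start_control n m) 0 (stream_items (directed P) A) [::] [::]).

Lemma word_capacity (c : nat) : (n + m + 2) ^ c <= 2 ^ word_bits c n m.
Proof.
rewrite /word_bits mulnC expnM; case: c => // c.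
by rewrite leq_exp2r // up_logP.
Qed.

(** A word constant of at least 3 makes [B] at least [(n + m + 2) ^ 3], which dominates the size of
    both representations. The factor [2 * m] counts both orientations of each edge. *)
Lemma cube_bounds : [/\ n < B, m < B, 1 < B, n + 3 * (2 * m) <= B & 2 * (n * n) <= B].
Proof.
have [c3 _ _] := hM.
have : (n + m + 2) ^ 3 <= B.
  apply: leq_trans (word_capacity _); apply: leq_pexp2l => //; lia.
rewrite !expnS expn0 muln1 => le.
have le2 : (n + m + 2) * 2 * 2 <= (n + m + 2) * ((n + m + 2) * (n + m + 2)).
  by rewrite -mulnA leq_mul2l; apply/orP; right; nia.
have : (n + m + 2) * (n + m + 2) * 2 <= (n + m + 2) * ((n + m + 2) * (n + m + 2)).
  by rewrite -mulnA leq_mul2l; apply/orP; right; nia.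
split; nia.
Qed.

Lemma weight_bound e : e \in stream_items (directed P) A -> stamp e < B.
Proof.
case: hA => -[_ _ wt _] [_ mem_arcs] /mapP[a aA ->].
have := wt a.1 a.2; rewrite mem_arcs in aA; rewrite (eqP aA) => /(_ erefl) lt.
have [_ cw _] := hM; apply: leq_trans lt _; rewrite /B leq_pexp2l //.
by rewrite /word_bits leq_mul2r cw orbT.
Qed.

(** Acceptance requires a first flush, which forces the repeated arcs to be a permutation of those
    of the stream. Being sorted, they yield a legitimate representation of [G], and the remaining
    chunks replay [M] on it until it halts. *)
Lemma ideal_sound (xs : seq message) (s : state (seq item)) (o : seq nat) :
  irun start xs = Some (s, o) -> accepting p s -> o = answer P G.
Proof.
have [PI en] := hA.
case: (quiet_split xs) => [qx|[c [r [qc ->]]]] E acc.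
  have [|es Exs [le aes oes]] := first_run_inv qx _ E; first by [].
  move: E; rewrite Exs first_run //; last by case: le => [|->].
  by case=> Es _; move: acc; rewrite -Es /accepting.
move: E; rewrite run_cat; case E: run => [[s1 o1]|] //.
have [|es Exs [le aes oes]] := first_run_inv qc _ E; first by [].
move: E; rewrite Exs first_run //; last by case: le => [|->].
case=> <- <- /=; case: ifP => // pe; case E2: run => [[s2 o2]|] // [Es2 Eo2].
rewrite Es2 Eo2 in E2.
have [s' Es'] : exists s', es = map (@arc_item n) s'.
  apply: map_image => x; rewrite -(perm_mem pe) => /mapP[a _ ->]; by exists a.
have ps : perm_eq s' (arcs (directed P) A).
  by rewrite perm_sym; apply: (perm_map_inj (@arc_item_inj n)); rewrite -Es'.
have en' := enumerates_perm ps en; rewrite Es' in oes.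
have [uN rep] := cells_represent f en' oes; rewrite -Es' in uN rep.
have fM := fits_lookup uN (@cells_stamp f n None 0 es).
have [//|//|T [hT oT]] := second_phase_sound [::] _ _ fM E2 acc.
have [_ _ /(_ _ _ _ PI _ rep)] := hM.
rewrite /ram_run /ram_init /= => -[hT' oT'].
have Eq := halted_unique hT hT'.
by rewrite -oT' -Eq oT.
Qed.

Lemma ideal_complete : exists xs s, [/\ irun start xs = Some (s, answer P G),
  accepting p s, all (small (16 * B)) xs & size xs <= 10 * (m + t m n + 1)].
Proof.
have [PI en] := hA; have [nB mB B1 lB mmB] := cube_bounds.
pose es := sort (relpre key leq) (stream_items (directed P) A).
have pe : perm_eq (stream_items (directed P) A) es by rewrite perm_sym perm_sort.
have [s Es] : exists s, es = map (@arc_item n) s.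
  apply: map_image => x; rewrite -(perm_mem pe) => /mapP[a _ ->]; by exists a.
have ps : perm_eq s (arcs (directed P) A).
  by rewrite perm_sym; apply: (perm_map_inj (@arc_item_inj n)); rewrite -Es.
have oes : ordered None es.
  by rewrite /ordered /= sorted_map sort_sorted // => x y; apply: leq_total.
have [uN rep] : uniq (map key (cells f n None 0 es)) /\
    represents f G (lookup (cells f n None 0 es)).
  by rewrite Es; apply: cells_represent; [apply: enumerates_perm ps en | rewrite -Es].
have st := @cells_stamp f n None 0 es; set N := cells _ _ _ _ _ in uN rep st.
have ses : size es <= 2 * m.
  by rewrite -(perm_size pe) size_map; apply: leq_trans (size_arcs _ _) _; rewrite size_tuple.
have aes : all (in_graph n) es by rewrite Es; apply: in_graph_arcs.
have wes e : e \in es -> stamp e < B by rewrite -(perm_mem pe); apply: weight_bound.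
have NB x : x \in N -> key x < B /\ content x < B.
  by apply: cells_bounded => //; rewrite add0n; lia.
have sN : size N <= 6 * m by have := size_cells f n es None 0; rewrite -/N; lia.
have [_ _ /(_ _ _ _ PI _ rep)] := hM; rewrite /ram_run /ram_init => -[hT oT].
pose q := Control true 0 (regs (ram_init n m (fun=> 0))) None.
have sa : sane B p (cpc q) (cregs q) (lookup N) (map key N).
  split => //.
  - split => // [r|r] /=; first by case: eqP => // _; case: eqP => // _; lia.
    by rewrite /reg_bound; case: r => [|[|r]].
  - move=> a; case aN: (a \in map key N); last by rewrite lookup_notin ?aN //; lia.
    by case/mapP: aN => x xN ->; rewrite lookup_mem //; case: (NB x xN).
  - by apply/allP => _ /mapP[x xN ->]; case: (NB x xN).
  - by move=> a; apply: lookup_notin.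
have pN : perm_eq N (live (lookup N) (fun=> 0) (map key N)) by rewrite live_lookup.
have B0 : 0 < B by lia.
have [//|//|xs [s2 [o [E acc sxs szs Eo]]]] := honest_run f n B0 _ _ sa pN hT.
exists (map arc_message es ++ Flush :: xs), s2; split => //.
- rewrite run_cat first_run //=; last by lia.
  by rewrite pe /= E -oT Eo.
- rewrite all_cat /= sxs andbT all_map; apply/allP => e ees /=.
  have /andP[] := allP aes _ ees; have := wes e ees; lia.
(* There are at most [2 * m] arcs, one flush, and [6 * m + 4 * t m n + 1] messages for the run,
   which starts with at most [6 * m] cells. *)
- rewrite size_cat /= size_map; rewrite size_map in szs; lia.
Qed.

End Algorithm.

(** * Fingerprints *)

Definition within (U : nat) (x : item) : bool := [&& key x < U, content x < U & stamp x < U].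

Section Fingerprint.

Import GRing.Theory.
Local Open Scope ring_scope.

Variables (F : finFieldType) (e : item -> F).

Definition fingerprint (r : F) (L : seq item) : F := \prod_(x <- L) (r - e x).

Lemma fingerprint_cat (r : F) (L L' : seq item) :
  fingerprint r (L ++ L') = fingerprint r L * fingerprint r L'.
Proof. exact: big_cat. Qed.

Lemma fingerprint_perm (r : F) (L L' : seq item) :
  perm_eq L L' -> fingerprint r L = fingerprint r L'.
Proof. exact: perm_big. Qed.

(** The products are monic polynomials in [r] that determine their multisets of roots, and [e] is
    injective on bounded items. The difference is thus a nonzero polynomial of degree at most [D],
    with at most [D] roots. *)
Lemma fingerprint_collisions (d : F -> item) (U : nat) (L L' : seq item) (D : nat) :
  {in within U, cancel e d} -> all (within U) L -> all (within U) L' ->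
  (size L <= D)%N -> (size L' <= D)%N -> ~~ perm_eq L L' ->
  (#|[pred r | fingerprint r L == fingerprint r L']| <= D)%N.
Proof.
move=> eK aL aL' sL sL' nperm.
pose p (K : seq item) := \prod_(y <- map e K) ('X - y%:P).
have pE K r : (p K).[r] = fingerprint r K.
  by rewrite horner_prod big_map; apply: eq_bigr => x _; rewrite hornerXsubC.
have p0 : p L - p L' != 0.
  rewrite subr_eq0; apply: contra nperm => /eqP /prod_XsubC_eq.
  have dK K : all (within U) K -> map d (map e K) = K.
    move=> /allP aK; rewrite -map_comp -[RHS]map_id; apply/eq_in_map => x xK.
    exact/eK/aK.
  by move/(perm_map d); rewrite !dK.
have sp : (size (p L - p L')%R <= D.+1)%N.
  apply: leq_trans (size_polyD _ _) _.
  by rewrite size_polyN !size_prod_XsubC !size_map geq_max !ltnS sL.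
rewrite cardE -ltnS; apply: leq_trans sp; apply: max_poly_roots => //.
  by apply/allP => r; rewrite mem_enum /root !hornerE !pE subr_eq0.
exact: enum_uniq.
Qed.

End Fingerprint.

(** * Bounds against arbitrary helpers, and comparison of the ideal and the fingerprinted runs *)

Section Bounds.

Variables (f : input_form) (n B : nat) (p : seq instr).
Hypotheses (B_gt1 : 1 < B) (n_le : n <= B) (n2_le : 2 * (n * n) <= B).

(** A chunk may contain up to [2 * B] arcs, so list cells reach addresses up to about [7 * B], and
    stamps reach [2 * B]; [U] leaves room for all of them. *)
Let U := 16 * B.

Record good_control (q : control) (k : nat) : Prop := GoodControl {
  good_fits : fits_control U p (cpc q) (cregs q);
  good_mark : if mark q is Some a then a < U else true;
  good_clock : k <= 2 * B
}.

Lemma control_step_good (q q' : control) (k : nat) (x : message) (l r c : seq item)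
    (o : option nat) :
  good_control q k -> small U x -> k < 2 * B ->
  control_step f n B p q k x = Some (q', (l, r, c), o) ->
  [/\ good_control q' k.+1,
      [/\ all (within U) l, all (within U) r & all (within U) c],
      [/\ size l <= 2, size r <= 1 & size c <= 3]
    & forall y, o = Some y -> y < U].
Proof.
case=> ft mk kB; have [_ RU _] := ft.
have UE : U = 16 * B by []. clearbody U.
case: x => [u v w|fresh v k'|a v k'|] //=.
- move=> /and3P[uU vU wU] lt; case: ifP => // /and4P[_ un vn _] [<- <- <- <- <-].
  have lt2 := row_major_lt un vn.
  split => //=; last by case: f.
  split; rewrite /= ?/within /key /content /stamp /= ?uU ?vU ?wU //.
  by case: f => /=; try case: eqP; rewrite /=; lia.
- move=> /andP[vU kU] lt; case: ifP => // _.
  have ftc : fits_control U p (pc (blind_step B p q v)) (regs (blind_step B p q v)).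
    by apply: step_fits_control => //=; lia.
  have oU y : ohead (out (blind_step B p q v)) = Some y -> y < U.
    rewrite /blind_step /step; case: nth => //= r0 [<-]; exact: RU.
  case E: access => [[a w]|]; last by case=> <- <- <- <- <-.
  case: ifP => // _ [<- <- <- <- <-].
  have [aU wU] := access_lt RU vU E.
  split => //=; split => //; last by rewrite size_cat size_nseq; case: fresh.
    rewrite all_cat all_nseq /= /within /key /content /stamp /= aU vU wU kU.
    by rewrite orbT /=; lia.
  by rewrite /within /key /content /stamp /= aU vU kU.
- move=> /and3P[aU vU kU] lt; case: ifP => // _ [<- <- <- <- <-].
  split => //=; split => //; rewrite /= /within /key /content /stamp /= aU vU ?kU //; lia.
Qed.

Section Control.

Variables (C : Type) (add : C -> seq item -> C) (emp : C) (same : C -> C -> bool).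

(** Stated for any accumulator: in the fingerprinted run too, even after a collision, the control
    must keep fitting in the memory of the verifier. *)
Lemma mstep_good_control (s s' : state C) (x : message) (o : option nat) :
  good_control (ctl s) (clock s) -> small U x ->
  mstep f n B p add emp same s x = Some (s', o) ->
  good_control (ctl s') (clock s') /\ forall y, o = Some y -> y < U.
Proof.
move=> g sx; have H : (if x is Flush then False else True) ->
    mstep f n B p add emp same s x = Some (s', o) ->
    good_control (ctl s') (clock s') /\ forall y, o = Some y -> y < U.
  rewrite /mstep; case: x sx => // [u v w|fresh v k|a v k] sx _; case: ifP => // kB;
  case E: control_step => [[[q [[l r] c]] o']|] // [<- <-];
  by have [] := control_step_good g sx kB E.
case: x sx H => [u v w|fresh v k|a v k|] sx H; try by apply: H.
rewrite /=; case: ifP => // _ [<- <-] /=; split => //.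
by case: g => ft _ _; split.
Qed.

End Control.

(** At a flush [carried], at most three items for each of [2 * B] messages, becomes [written]: hence
    the [6 * B]. Both sides of a comparison have at most [6 * B + 2 * (2 * B)] items, which is the
    bound [10 * B] on collisions. *)
Record good (s : state (seq item)) : Prop := Good {
  good_ctl : good_control (ctl s) (clock s);
  good_within : [/\ all (within U) (written s), all (within U) (consumed s)
                  & all (within U) (carried s)];
  good_size : [/\ size (written s) <= 6 * B + 2 * clock s, size (consumed s) <= clock s
                & size (carried s) <= 3 * clock s]
}.

Notation istep := (mstep f n B p cat [::] (@perm_eq item)).
Notation irun := (run f n B p cat [::] (@perm_eq item)).

Lemma mstep_good (s s' : state (seq item)) (x : message) (o : option nat) :
  good s -> small U x -> istep s x = Some (s', o) -> good s'.
Proof.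
move=> g sx E; have [gc _] := mstep_good_control (good_ctl g) sx E.
case: (g) => _ [aw ac an] [sw sc sn].
have H : (if x is Flush then False else True) -> good s'.
  move: E; rewrite /mstep; case: x sx => // [u v w|fresh v k|a v k] sx; case: ifP => // kB;
  case E: control_step => [[[q [[l r] c]] o']|] // [Es _] _;
  have [gq [al ar ak] [sl sr sk] _] := control_step_good (good_ctl g) sx kB E;
  rewrite -Es; split => //=; rewrite ?Es // ?all_cat ?aw ?ac ?an //;
  rewrite !size_cat; split; lia.
case: x sx E H => [u v w|fresh v k|a v k|] sx E H; try by apply: H.
move: E gc; rewrite /=; case: ifP => // _ [<- _] /= gc; split => //=; split => //.
by have := good_clock (good_ctl g); lia.
Qed.

Section Real.

Variables (F : finFieldType) (e : item -> F) (d : F -> item).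
Hypothesis eK : {in within U, cancel e d}.

Definition absorb (r c : F) (L : seq item) : F := (c * fingerprint e r L)%R.

Definition hashed (r : F) (s : state (seq item)) : state F :=
  State (ctl s) (clock s) (fingerprint e r (written s)) (fingerprint e r (consumed s))
    (fingerprint e r (carried s)).

Notation rstep r := (mstep f n B p (absorb r) 1%R eq_op).
Notation rrun r := (run f n B p (absorb r) 1%R eq_op).

Lemma mstep_hashed (r : F) (s s' : state (seq item)) (x : message) (o : option nat) :
  istep s x = Some (s', o) -> rstep r (hashed r s) x = Some (hashed r s', o).
Proof.
have nil1 : fingerprint e r [::] = 1%R by apply: big_nil.
rewrite /mstep; case: x => [u v w|fresh v k|a v k|]; last first.
  by case: ifP => // pe [<- <-]; rewrite /= (fingerprint_perm e r pe) eqxx /hashed /= nil1.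
all: rewrite /=; case: ifP => // kB;
  case E: (if _ then _ else _) => [[[q [[l r'] c]] o']|] // [<- <-];
  by rewrite /hashed /absorb /= !fingerprint_cat.
Qed.

Lemma mstep_hashed_none (r : F) (s : state (seq item)) (x : message) :
  (if x is Flush then false else true) -> istep s x = None -> rstep r (hashed r s) x = None.
Proof.
rewrite /mstep; case: x => // [u v w|fresh v k|a v k] _; case: ifP => // kB;
  rewrite [ctl (hashed r s)]/= [clock (hashed r s)]/=;
  by case: control_step => [[[q [[l r'] c]] o']|].
Qed.

Lemma run_hashed (r : F) (xs : seq message) (s s' : state (seq item)) (o : seq nat) :
  irun s xs = Some (s', o) -> rrun r (hashed r s) xs = Some (hashed r s', o).
Proof.
elim: xs s o => [|x xs IH] s o /=; first by case=> <- <-.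
case E: mstep => [[s1 o1]|] //; case E1: run => [[s2 o2]|] // [Es <-].
by rewrite Es in E1; rewrite (mstep_hashed r E) (IH _ _ E1).
Qed.

(** The messages do not depend on [r], so the ideal run fails at one definite message, up to which
    all fingerprinted runs agree with it. They can only survive it if it is a flush and [r] is a
    collision there. One flush counts, and no union bound over the chunks is taken. *)
Lemma run_hashed_rare (xs : seq message) (s : state (seq item)) :
  good s -> all (small U) xs -> irun s xs = None ->
  #|[pred r | rrun r (hashed r s) xs]| <= 10 * B.
Proof.
elim: xs s => [|x xs IH] s g //= /andP[sx sxs].
case E: mstep => [[s1 o1]|]; last first.
  move=> _; case: x sx E => [u v w|fresh v k|a v k|] sx E; last first.
    move: E => /=; case: ifP => // /negbT npe _.
    have [_ [aw ac _] [sw sc _]] := g; have kB := good_clock (good_ctl g).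
    apply: leq_trans (fingerprint_collisions eK aw ac _ _ npe); last 2 first.
    - by lia.
    - by lia.
    by apply: subset_leq_card; apply/subsetP => r; rewrite !inE; case: eqP.
  1-3: by rewrite (eq_card0 (A := _)) // => r; rewrite inE mstep_hashed_none.
case E1: (irun s1 xs) => [[s2 o2]|] // _.
apply: leq_trans (IH s1 (mstep_good g sx E) sxs E1).
apply: subset_leq_card; apply/subsetP => r; rewrite !inE (mstep_hashed r E).
by case: (rrun r (hashed r s1) xs).
Qed.

End Real.

End Bounds.

(** * The verifier *)

Lemma retract_exists (S T : finType) (s0 : S) :
  #|S| <= #|T| -> exists g : T -> S, forall s, exists t, g t = s.
Proof.
move=> le; pose h (s : S) : T := enum_val (widen_ord le (enum_rank s)).
have hI : injective h.
  by move=> s s' /enum_val_inj/(congr1 val) /= /val_inj/enum_rank_inj.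
exists (fun t => odflt s0 [pick s | h s == t]) => s; exists (h s).
by case: pickP => [s' /eqP/hI//|/(_ s)]; rewrite eqxx.
Qed.

Lemma encoder_exists (T A : Type) (t0 : T) (dec : T -> A) :
  exists enc : A -> T, forall a, (exists t, dec t = a) -> dec (enc a) = a.
Proof.
exists (fun a => epsilon (inhabits t0) (fun t => dec t = a)) => a.
exact: epsilon_spec.
Qed.

Lemma least_exists (Q : nat -> Prop) (k : nat) :
  Q k -> exists2 l, Q l & forall j, Q j -> l <= j.
Proof.
elim/ltn_ind: k => k IH Qk; case: (classic (exists2 j, j < k & Q j)) => [[j]|no].
  exact: IH.
by exists k => // j Qj; rewrite leqNgt; apply/negP => lt; apply: no; exists j.
Qed.

Section Probability.

Import Order.TTheory GRing.Theory Num.Theory.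

Lemma prob_sure (T : finType) (E : pred T) (x : T) : (forall y, E y) -> prob E = 1%R.
Proof.
move=> ET; rewrite /prob (eq_card (B := T)); last by move=> y; rewrite !inE; apply: ET.
rewrite divff // pnatr_eq0 -lt0n; apply/card_gt0P; by exists x.
Qed.

Lemma prob_third (T : finType) (E : pred T) :
  3 * #|E| <= #|T| -> (prob E <= 1 / 3%:R)%R.
Proof.
rewrite /prob; case: (posnP #|T|) => [->|T0] le.
  by rewrite invr0 mulr0 divr_ge0.
by rewrite ler_pdivrMr ?ltr0n // mulrAC ler_pdivlMr ?ltr0n // mul1r -natrM ler_nat mulnC.
Qed.

End Probability.

Lemma word_space (B b : nat) : 1 < B -> 8 * (16 * B) ^ 3 <= 2 ^ b ->
  [/\ (2 * B).+1 <= 2 ^ b, 16 * B <= 2 ^ b, (16 * B) ^ 3 <= 2 ^ b & 3 * (10 * B) <= 2 ^ b].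
Proof. by move=> B1; rewrite !expnS expn0 muln1 => le; split; nia. Qed.

(** One word each for the challenge, the control, the clock and the three fingerprints; the dead
    state adds one value, which a seventh word accommodates. *)
Lemma state_space (N X Y : nat) : 1 < N -> X <= N -> Y <= N ->
  (N * (X * Y * N * N * N)).+1 <= N ^ 7.
Proof.
move=> N1 XN YN; have le : N * (X * Y * N * N * N) <= N ^ 6.
  rewrite (_ : N ^ 6 = N * (N * N * N * N * N)); last by rewrite !expnS expn0 muln1 !mulnA.
  by rewrite leq_mul2l !leq_mul2r leq_mul ?orbT.
by apply: leq_ltn_trans le _; rewrite ltn_exp2l.
Qed.

Section Verifier.

Variables (f : input_form) (n m B : nat) (p : seq instr) (dir : bool) (b : nat).
Let U := 16 * B.
Hypotheses (B_gt1 : 1 < B) (n_lt : n < B) (m_lt : m < B) (n2_le : 2 * (n * n) <= B).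
(** A message is three bits and three numbers below [U]. The control is a bit, a program counter,
    the registers and an optional mark. Each fits in one word. *)
Hypotheses (message_fits : 8 * U ^ 3 <= 2 ^ b)
  (control_space : 2 * pc_bound p * U ^ reg_bound p * U.+1 <= 2 ^ b).
Variable F : finFieldType.
Hypothesis card_F : #|F| = 2 ^ b.

Lemma ltU (x : nat) : x < B -> x < U.
Proof. by move/leq_trans; apply; rewrite leq_pmull. Qed.

Lemma U_gt0 : 0 < U.
Proof. exact/ltU/ltnW. Qed.

Let u0 : 'I_U := Ordinal U_gt0.

Definition fin_control : finType :=
  (bool * 'I_(pc_bound p) * {ffun 'I_(reg_bound p) -> 'I_U} * option 'I_U)%type.

Definition control_of (x : fin_control) : control :=
  let: (r, i, R, q) := x in
  Control r i (fun j => if insub j is Some j' then R j' : nat else 0)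
    (omap (@nat_of_ord U) q).

Lemma control_ofP (q : control) (k : nat) :
  good_control B p q k -> exists x, control_of x = q.
Proof.
case: q => r i R q [[/= ip RU R0] qU _].
have [q' Eq] : exists q' : option 'I_U, omap (@nat_of_ord U) q' = q.
  case: q qU => [a aU|_]; last by exists None.
  by exists (Some (Ordinal aU)).
exists (r, Ordinal ip, [ffun j : 'I_(reg_bound p) => Ordinal (RU j)], q').
rewrite /= Eq; congr Control; apply: functional_extensionality => j.
case: insubP => [j' _ <-|]; first by rewrite ffunE.
by rewrite -leqNgt => /R0.
Qed.

Definition fin_state : finType :=
  option (F * (fin_control * 'I_(2 * B).+1 * F * F * F))%type.

Definition memory : Type := option (F * state F).

Definition memory_of (x : fin_state) : memory :=
  if x is Some (r, (q, k, cl, cr, cn)) then Some (r, State (control_of q) k cl cr cn)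
  else None.

Definition good_memory (x : memory) : Prop :=
  if x is Some (_, s) then good_control B p (ctl s) (clock s) else True.

Lemma memory_ofP (x : memory) : good_memory x -> exists y, memory_of y = x.
Proof.
case: x => [[r [q k cl cr cn]]|] /=; last by exists None.
move=> g; have [q' <-] := control_ofP g; have kB : k < (2 * B).+1 by case: g.
by exists (Some (r, (q', Ordinal kB, cl, cr, cn))).
Qed.

Lemma card_fin_state : #|fin_state| <= #|[the finType of 7.-tuple (word b)]|.
Proof.
rewrite card_tuple card_ord card_option !card_prod card_F.
rewrite card_ffun !card_ord card_option card_ord card_bool.
have [kB _ _ _] := word_space B_gt1 message_fits.
apply: state_space; [|exact: control_space|exact: kB].
by apply: leq_trans kB; rewrite ltnS muln_gt0 /=; apply: ltnW.
Qed.

(** Only the size of the memory is limited, so a cardinality argument replaces an explicit packing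
    of states into words. *)
Lemma decoder_exists : exists (enc : memory -> 7.-tuple (word b))
  (dec : 7.-tuple (word b) -> memory), forall x, good_memory x -> dec (enc x) = x.
Proof.
have [g gK] := retract_exists (None : fin_state) card_fin_state.
have [t0 _] := gK None.
have [enc encK] := encoder_exists t0 (memory_of \o g).
exists enc, (memory_of \o g) => x /memory_ofP[y <-]; apply: encK.
by have [t <-] := gK y; exists t.
Qed.

Definition fin_message : finType := (bool * bool * bool * 'I_U * 'I_U * 'I_U)%type.

Definition message_of (x : fin_message) : message :=
  let: (t1, t2, fresh, a, v, k) := x in
  if t1 then if t2 then Arc a v k else Exec fresh v k
  else if t2 then Final a v k else Flush.

Lemma small_message_of (x : fin_message) : small U (message_of x).
Proof. by case: x => [[[[[[] []] []] a] v] k] /=; rewrite ?ltn_ord. Qed.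

Lemma message_ofP (x : message) : small U x -> exists y, message_of y = x.
Proof.
case: x => [u v w|fresh v k|a v k|] /=.
- by case/and3P=> h1 h2 h3; exists (true, true, true, Ordinal h1, Ordinal h2, Ordinal h3).
- by case/andP=> h1 h2; exists (true, false, fresh, u0, Ordinal h1, Ordinal h2).
- by case/and3P=> h1 h2 h3; exists (false, true, true, Ordinal h1, Ordinal h2, Ordinal h3).
- by exists (false, false, true, u0, u0, u0).
Qed.

(** The decoder is total, so that every annotation of a dishonest helper reads as a sequence of
    bounded messages. *)
Lemma message_decoder_exists : exists dec : word b -> message,
  (forall c, small U (dec c)) /\ forall x, small U x -> exists c, dec c = x.
Proof.
have [||g gK] := @retract_exists fin_message (word b).
- exact: (true, true, true, u0, u0, u0).
- rewrite !card_prod !card_ord card_bool; apply: leq_trans message_fits.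
  by rewrite !expnS expn0 muln1 !mulnA.
exists (message_of \o g); split=> [c|x /message_ofP[y <-]]; first exact: small_message_of.
by have [c <-] := gK y; exists c.
Qed.

Lemma item_coding_exists : exists (e : item -> F) (d : F -> item),
  {in within U, cancel e d}.
Proof.
have [||g gK] := @retract_exists ('I_U * 'I_U * 'I_U)%type F.
- exact: (u0, u0, u0).
- have [_ _ U3 _] := word_space B_gt1 message_fits.
  by rewrite !card_prod !card_ord card_F -mulnA.
pose d (r : F) : item := let: (a, v, k) := g r in (val a, val v, val k).
have [e eK] := encoder_exists (0%R : F) d; exists e, d => -[[a v] k] /and3P[aU vU kU].
apply: eK; have [r Er] := gK (Ordinal aU, Ordinal vU, Ordinal kU).
by exists r; rewrite /d Er.
Qed.

Definition challenge (c : word b) : F := enum_val (cast_ord (esym card_F) c).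

Lemma challenge_inj : injective challenge.
Proof. by move=> c c' /enum_val_inj/cast_ord_inj. Qed.

Variables (enc : memory -> 7.-tuple (word b)) (dec : 7.-tuple (word b) -> memory).
Hypothesis decK : forall x, good_memory x -> dec (enc x) = x.
Variable dmsg : word b -> message.
Hypothesis dmsg_small : forall c, small U (dmsg c).
Variable e : item -> F.

Notation rstep r := (mstep f n B p (absorb e r) 1%R eq_op).
Notation rrun r := (run f n B p (absorb e r) 1%R eq_op).

Lemma word_gt0 : 0 < 2 ^ b. Proof. by rewrite expn_gt0. Qed.

Definition to_word (y : nat) : word b := insubd (Ordinal word_gt0) y.

Lemma to_wordK (y : nat) : y < U -> val (to_word y) = y.
Proof.
move=> yU; rewrite val_insubd; have [_ Ub _ _] := word_space B_gt1 message_fits.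
by rewrite (leq_trans yU Ub).
Qed.

(** The first move draws the challenge and keeps it in memory; a failed check leads to [None], a
    dead state that never accepts. *)
Definition annotation_verifier : verifier n b 7 := Verifier
  (fun c => enc (Some (challenge c, State (start_control n m) 0 1%R 1%R 1%R)))
  (fun _ q a => enc (if dec q is Some (r, s) then
      Some (r, State (ctl s) (clock s) (absorb e r (written s) (stream_items dir [:: a]))
                 (consumed s) (carried s)) else None))
  (fun _ q c =>
     if dec q is Some (r, s) then
       if rstep r s (dmsg c) is Some (s', o) then (enc (Some (r, s')), omap to_word o)
       else (enc None, None)
     else (enc None, None))
  (fun q => if dec q is Some (_, s) then accepting p s else false).

Notation V := annotation_verifier.
Notation start A := (State (start_control n m) 0 (stream_items dir A) [::] [::]).

Lemma start_good : good_control B p (start_control n m) 0.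
Proof.
split => //; split => //= r; first by case: eqP => _; [|case: eqP => _]; rewrite ?U_gt0 ?ltU.
by rewrite /reg_bound; case: r => [|[|r]].
Qed.

Lemma after_streamE (A : m.-tuple (edge n)) (a : seq (word b))
    (rho : coins b m (size a)) :
  after_stream V A rho = enc (Some (challenge rho.1.1, hashed e (challenge rho.1.1) (start A))).
Proof.
rewrite /after_stream /=; set r := challenge _.
have gen (zs : seq (word b * edge n)) c :
  foldl (fun q x => v_stream V x.1 q x.2)
    (enc (Some (r, State (start_control n m) 0 c 1%R 1%R))) zs =
  enc (Some (r, State (start_control n m) 0
    (absorb e r c (stream_items dir (unzip2 zs))) 1%R 1%R)).
  elim: zs c => [|[c0 x] zs IH] c /=.
    by rewrite /absorb /fingerprint big_nil GRing.mulr1.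
  rewrite decK; last exact: start_good.
  rewrite IH; do 3 f_equal; rewrite /absorb -GRing.mulrA -fingerprint_cat.
  by rewrite /stream_items -map_cat /arcs /= cats0.
rewrite gen unzip2_zip ?size_tuple // /hashed /= /absorb GRing.mul1r.
by rewrite /fingerprint big_nil.
Qed.

Lemma after_annotE (A : m.-tuple (edge n)) (a : seq (word b)) (rho : coins b m (size a)) :
  let r := challenge rho.1.1 in
  if rrun r (hashed e r (start A)) (map dmsg a) is Some (s, o) then
    after_annot V A rho = (enc (Some (r, s)), map to_word o) /\
    good_control B p (ctl s) (clock s) /\ all (gtn U) o
  else dec (after_annot V A rho).1 = None.
Proof.
move=> r; rewrite /after_annot after_streamE -/r.
have -> : map dmsg a = map dmsg (unzip2 (zip rho.2 a)).
  by rewrite unzip2_zip // size_tuple.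
have g0 : good_control B p (ctl (hashed e r (start A))) (clock (hashed e r (start A))).
  exact: start_good.
have gen (zs : seq (word b * word b)) s os : good_control B p (ctl s) (clock s) ->
  let res := foldl (fun s0 x => let: (q, o) := v_annot V x.1 s0.1 x.2 in
      (q, if o is Some y then rcons s0.2 y else s0.2)) (enc (Some (r, s)), os) zs in
  if rrun r s (map dmsg (unzip2 zs)) is Some (s', o) then
    res = (enc (Some (r, s')), os ++ map to_word o) /\
    good_control B p (ctl s') (clock s') /\ all (gtn U) o
  else dec res.1 = None.
  elim: zs s os => [|[c0 c] zs IH] s os g /=; first by rewrite cats0.
  rewrite decK //; case E: mstep => [[s1 o1]|]; last first.
    have dead os' : dec (foldl (fun s0 x => let: (q, o) := v_annot V x.1 s0.1 x.2 in
        (q, if o is Some y then rcons s0.2 y else s0.2)) (enc None, os') zs).1 = None.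
      by elim: zs {IH} os' => [|[c1 c2] zs IH] os' /=; rewrite decK.
    exact: dead.
  have n_le : n <= B := ltnW n_lt.
  have [g1 o1U] := mstep_good_control B_gt1 n_le n2_le g (dmsg_small c) E.
  have := IH s1 (if omap to_word o1 is Some y then rcons os y else os) g1.
  rewrite /=; case: run => [[s2 o2]|] // [-> [g2 o2U]]; split; last split => //.
    by case: (o1) => [y|] //=; rewrite cat_rcons.
  by rewrite all_cat o2U andbT; case: (o1) o1U => //= y /(_ _ erefl) ->.
have := gen (zip rho.2 a) _ [::] g0; rewrite /=.
by case: run => [[s o]|].
Qed.

Lemma outputE (A : m.-tuple (edge n)) (a : seq (word b)) (rho : coins b m (size a)) :
  let r := challenge rho.1.1 in
  output V A rho =
  if rrun r (hashed e r (start A)) (map dmsg a) is Some (s, o) then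
    if accepting p s then Some o else None
  else None.
Proof.
move=> r; have := after_annotE A rho; rewrite -/r /output.
case: (after_annot V A rho) => q os; case: run => [[s o]|]; last by rewrite /= => ->.
case=> -[-> ->] [g oU] /=; rewrite decK //; case: ifP => // _; congr Some.
rewrite -map_comp -[RHS]map_id; apply/eq_in_map => y yo /=; apply: to_wordK.
exact: (allP oU).
Qed.

(** The bad event is confined to the first coin through the injective [challenge]: at most [10 * B]
    of the [2 ^ b] words are bad, and [3 * (10 * B) <= 2 ^ b]. *)
Lemma rare_third (A : m.-tuple (edge n)) (a : seq (word b)) (W : pred F) :
  #|W| <= 10 * B ->
  (forall rho : coins b m (size a), output V A rho != None -> W (challenge rho.1.1)) ->
  third_invalid_on V A a.
Proof.
move=> sW oW; apply: prob_third.
pose W' : pred (word b) := [pred c | W (challenge c)].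
have sW' : #|W'| <= 10 * B.
  rewrite -(card_image challenge_inj); apply: leq_trans sW; apply: subset_leq_card.
  by apply/subsetP => _ /imageP[c cW ->].
pose E' := [predX [predX W' & predT : pred (m.-tuple (word b))] &
            predT : pred ((size a).-tuple (word b))].
have : #|[pred rho : coins b m (size a) | output V A rho != None]| <= #|E'|.
  by apply: subset_leq_card; apply/subsetP => -[[c x] y] /oW; rewrite !inE /= => ->.
rewrite !cardX /coins !card_prod card_ord.
move: #|W'| sW' => w sW'; move: #|_| #|_| #|_| => x y z le.
apply: leq_trans (leq_mul (leqnn 3) le) _.
rewrite !mulnA !leq_mul2r; apply/orP; right; apply/orP; right.
have [_ _ _ U3] := word_space B_gt1 message_fits.
exact: leq_trans (leq_mul (leqnn 3) sW') U3.
Qed.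

End Verifier.

(** * The word length of the verifier, and the protocol *)

Definition verifier_word_const (M : ram_algorithm) : nat :=
  4 * (word_const M + 4) + pc_bound (program M) + (word_const M + 4) * reg_bound (program M) + 8.

(** The factor 16 in [U] adds 4 bits to a word of the RAM. In the constant, the first summand pays
    for [U ^ 3] and for the mark, the second for the program counter since [k <= 2 ^ k], the third
    for the registers, and 8 for the remaining factors, the logarithm being at least 1. *)
Lemma verifier_words (M : ram_algorithm) (n m : nat) :
  let U := 16 * 2 ^ word_bits (word_const M) n m in
  let b := word_bits (verifier_word_const M) n m in
  8 * U ^ 3 <= 2 ^ b /\
  2 * pc_bound (program M) * U ^ reg_bound (program M) * U.+1 <= 2 ^ b.
Proof.
move=> U b; set k := pc_bound _; set r := reg_bound _.
have l1 : 0 < up_log 2 (n + m + 2) by rewrite up_log_gt0 /=; lia.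
have UE : U = 2 ^ (word_bits (word_const M) n m + 4) by rewrite /U expnD mulnC.
have pc2 : k <= 2 ^ k by apply/ltnW/ltn_expl.
have U2 : U.+1 <= 2 ^ (word_bits (word_const M) n m + 5).
  by rewrite UE (addnS _ 4) expnS mul2n -addnn -addn1 leq_add2l expn_gt0.
split.
  rewrite UE -expnM (_ : 8 = 2 ^ 3) // -expnD leq_pexp2l //.
  by rewrite /b /verifier_word_const /word_bits; nia.
have : 2 * k * U ^ r * U.+1 <= 2 ^ 1 * 2 ^ k * U ^ r * 2 ^ (word_bits (word_const M) n m + 5).
  by rewrite leq_mul // leq_mul2r leq_mul2l pc2 !orbT.
move/leq_trans; apply; rewrite UE -expnM -!expnD leq_pexp2l //.
rewrite /b /verifier_word_const -/k -/r /word_bits; nia.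
Qed.

Lemma verifier_exists (P : graph_problem) (M : ram_algorithm) (f : input_form)
    (t : nat -> nat -> nat) (hM : solves_in_time M f P t) (n m : nat) :
  exists V : verifier n (word_bits (verifier_word_const M) n m) 7,
    valid_protocol P m V /\
    exists2 L, is_help_cost P m V L & L <= 10 * (m + t m n + 1).
Proof.
set b := word_bits _ n m.
have [fitsU space] := verifier_words M n m; rewrite -/b in fitsU space.
set B := 2 ^ word_bits (word_const M) n m in fitsU space.
set p := program M in space.
have [nB mB B1 lB n2B] := cube_bounds hM n m; rewrite -/B in nB mB B1 lB n2B.
have b0 : 0 < b.
  by rewrite /b /word_bits muln_gt0 up_log_gt0 /verifier_word_const /=; lia.
have [F _ cardF] := @pPrimePowerField 2 b isT b0.
have [enc [dec decK]] := decoder_exists B1 fitsU space cardF.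
have [dmsg [dsmall dsurj]] := message_decoder_exists B1 fitsU.
have [e [d eK]] := item_coding_exists B1 fitsU cardF.
pose V := annotation_verifier f n m B p (directed P) cardF enc dec dmsg e.
have oE := outputE f (directed P) B1 nB mB n2B fitsU cardF decK dsmall e.
have rare := rare_third (f := f) (n := n) (m := m) (p := p) (dir := directed P)
  (enc := enc) (dec := dec) (dmsg := dmsg) (e := e) B1 fitsU (card_F := cardF).
pose irun := run f n B p cat [::] (@perm_eq item).
pose start (A : seq (edge n)) :=
  State (start_control n m) 0 (stream_items (directed P) A) [::] [::].
pose coins0 l : coins b m l := let z := Ordinal (word_gt0 b) in
  (z, [tuple of nseq m z], [tuple of nseq l z]).
have sound (A : m.-tuple (edge n)) G a : graph_stream P A G ->
    valid_on V A a (answer P G) \/ third_invalid_on V A a.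
  move=> hA; have sa : all (small (16 * B)) (map dmsg a).
    by rewrite all_map; apply/allP => c _ /=.
  (* The ideal run depends on the annotation and not on the coins, and it decides the case: if it
     fails, an output is rare; if it accepts, the output is right for all coins; otherwise it is
     bottom for all coins. *)
  case E: (irun (start A) (map dmsg a)) => [[s o]|]; last first.
    right; pose W : pred F := [pred r | run f n B p (absorb e r) 1%R eq_op
      (hashed e r (start A)) (map dmsg a)].
    apply: (rare A a W); last first.
      by move=> rho; rewrite oE /W /=; case: run => [[]|].
    apply: (run_hashed_rare B1 (ltnW nB) n2B eK _ sa E).
    split; first exact: start_good.
      split=> //; apply/allP => x xA; have := weight_bound hM hA xA; rewrite -/B.
      have /allP/(_ _ xA)/andP[] := in_graph_arcs (arcs (directed P) A).
      by rewrite /within; lia.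
    split => //=; rewrite size_map.
    have := size_arcs (directed P) A; rewrite size_tuple; lia.
  case acc: (accepting p s).
    left; apply: prob_sure; first exact: coins0.
    move=> rho; rewrite oE (run_hashed _ _ E) /= -[accepting _ _]/(accepting p s) acc.
    by rewrite (ideal_sound hM hA E acc).
  right; apply: (rare A a pred0); first by rewrite card0.
  by move=> rho; rewrite oE (run_hashed _ _ E) /= -[accepting _ _]/(accepting p s) acc.
(* Inputs that are no graph stream get the empty annotation. For the others it is built from one
   graph, and [ideal_sound] gives validity for every graph that the stream represents. *)
have complete (A : m.-tuple (edge n)) : exists a, forall G, graph_stream P A G ->
    valid_on V A a (answer P G) /\ size a <= 10 * (m + t m n + 1).
  case: (classic (exists G, graph_stream P A G)) => [[G hA]|no]; last first.
    by exists [::] => G hA; case: no; exists G.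
  have [xs [s [E acc sxs szs]]] := ideal_complete hM hA.
  have [a Ea] : exists a, xs = map dmsg a.
    elim: xs sxs {E szs} => [|x xs IH] /=; first by exists [::].
    by case/andP=> /dsurj[c <-] /IH[a ->]; exists (c :: a).
  exists a => G' hA'; split; last by move: szs; rewrite Ea size_map.
  apply: prob_sure; first exact: coins0.
  rewrite Ea in E => rho; rewrite oE (run_hashed _ _ E) /= -[accepting _ _]/(accepting p s) acc.
  by rewrite (ideal_sound hM hA' E acc).
pose H : helper n b m := fun A => proj1_sig (constructive_indefinite_description _ (complete A)).
have HP A G (hA : graph_stream P A G) :
    valid_on V A (H A) (answer P G) /\ size (H A) <= 10 * (m + t m n + 1).
  by rewrite /H; case: constructive_indefinite_description => a /= /(_ _ hA).
have vH : valid_helper P V H by move=> A G /HP[].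
exists V; split; first by split=> [|H' A G]; [exists H | apply: sound].
(* The help cost is the least bound over all valid helpers; it exists because the helper [H]
   provides one bound, and it is no larger than that. *)
pose Q L := exists2 H : helper n b m, valid_helper P V H & annotation_at_most P H L.
have Q0 : Q (10 * (m + t m n + 1)) by exists H => // A G hA; case: (HP A G hA).
have [L QL minL] := least_exists Q0.
exists L; first by split => // H' L' vH' aH'; apply: minL; exists H'.
by apply: minL; exists H => // A G /HP[].
Qed.

Theorem theorem5 (P : graph_problem) (M : ram_algorithm) (f : input_form)
    (t : nat -> nat -> nat) (hM : solves_in_time M f P t) :
  has_protocol P (fun m n => m + t m n) (fun _ _ => 1).
Proof.
pose V n m := constructive_indefinite_description _ (verifier_exists hM n m).
exists (verifier_word_const M), 10, (fun _ _ => 7), (fun n m => proj1_sig (V n m)).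
split; first by rewrite /verifier_word_const; lia.
by move=> n m; have [vp hc] := proj2_sig (V n m); split.
Qed.
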